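(* Let $F$ be a number field, $M$ an snt-module over $F$ with a decomposition $M=M_-\oplus M_+$ into $F[[t]]$-stable Lagrangian subspaces, $V$ a finite-dimensional $F$-vector space with a non-degenerate symmetric bilinear form $(\,,\,)$, and $G$ the orthogonal group of $V$. The $G(F[[t]])$-orbits in $M_-\otimes_FV$ are in one-to-one correspondence with the set of pairs $(W,i)$ with $W\in Gr(M_-,t)$ and $i\in S_t^2(W)$ such that $U(i)_F$ is not empty. The correspondence is the following: for $x\in M_-\otimes_FV$, its orbit corresponds to the pair $(W,i)$ where $W=\mathrm{Im}\,f_x$ and $i=T_W(x)$.
   Context: An snt-module is a finite-dimensional $F$-vector space $M$ which is an $F[t]$-module on which some power of $t$ acts as $0$ (hence an $F[[t]]$-module), with a symplectic form such that $\langle t\xi,\eta\rangle=\langle\xi,t\eta\rangle$. $Gr(M_-,t)$ is the set of $F[[t]]$-submodules of $M_-$. Put $V[[t]]=V\otimes_FF[[t]]$, with $(\,,\,)$ extended $F[[t]]$-bilinearly. $G(F[[t]])$ acts (from the right) on $M_-\otimes_FV=M_-\otimes_{F[[t]]}V[[t]]$ through the second factor. For $x=\sum_iu_i\otimes v_i\in M_-\otimes_{F[[t]]}V[[t]]$, $f_x:V[[t]]\to M_-$ is the $F[[t]]$-linear map $f_x(v)=\sum_i(v_i,v)u_i$; one has $x\in\mathrm{Im}\,f_x\otimes_{F[[t]]}V[[t]]=\mathrm{Im}\,f_x\otimes_FV$. For an $F[[t]]$-submodule $W\subset M_-$, $S_t^2(W)\subset W\otimes_{F[[t]]}W$ is the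 submodule of symmetric tensors and $T_W:W\otimes_FV=W\otimes_{F[[t]]}V[[t]]\to S_t^2(W)$ is $T_W(\sum_iw_i\otimes v_i)=\sum_{i,j}(v_i,v_j)\,w_i\otimes w_j$. For $i\in S_t^2(W)$, $U(i)$ is the $F$-variety consisting of the points of $T_W^{-1}(i)$ at which $T_W$ is submersive, and $U(i)_F$ is its set of $F$-points. *)

(* Defs.v *)
From HB Require Import structures.
From mathcomp Require Import all_boot all_algebra all_field.
From mathcomp Require Import sesquilinear.
From mathcomp Require Import boolp classical_sets functions.

Set Implicit Arguments.
Unset Strict Implicit.
Unset Printing Implicit Defensive.

Import GRing.Theory.
Local Open Scope ring_scope.
Local Open Scope classical_set_scope.
Local Open Scope quotient_scope.

Lemma triangular_sum (C : nmodType) (G : nat -> nat -> C) n :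
  \sum_(i < n) \sum_(j < n - i) G i j = \sum_(l < n) \sum_(i < l.+1) G i (l - i)%N.
Proof.
elim: n => [|n IH]; first by rewrite !big_ord0.
rewrite [RHS]big_ord_recr /= -IH [LHS]big_ord_recr /= subSn // subnn.
rewrite big_ord_recl big_ord0 addr0 [X in _ = _ + X]big_ord_recr /= subnn addrA.
congr (_ + _); rewrite -big_split /=; apply: eq_bigr => i _.
by rewrite subSn ?(ltnW (ltn_ord i)) // big_ord_recr.
Qed.

Lemma square_sum (C : nmodType) (G : nat -> nat -> C) n :
  (forall i j, (n <= i + j)%N -> G i j = 0) ->
  \sum_(i < n) \sum_(j < n) G i j = \sum_(l < n) \sum_(i < l.+1) G i (l - i)%N.
Proof.
move=> G0; rewrite -triangular_sum; apply: eq_bigr => i _.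
rewrite [RHS](big_ord_widen n (G i)) ?leq_subr // [RHS]big_mkcond /=.
by apply: eq_bigr => j _; case: ltnP => //; rewrite leq_subLR => /G0.
Qed.

(* The tensor product over R: finite formal sums of pairs, written as           *)
(* sequences, modulo the congruence generated by the bilinearity relations.     *)

Section Tensor.
Variables (R : comNzRingType) (A B : lmodType R).
Implicit Types (s : seq (A * B)).

Inductive tens_eqv : seq (A * B) -> seq (A * B) -> Prop :=
| tens_refl s : tens_eqv s s
| tens_sym s1 s2 : tens_eqv s1 s2 -> tens_eqv s2 s1
| tens_trans s1 s2 s3 : tens_eqv s1 s2 -> tens_eqv s2 s3 -> tens_eqv s1 s3
| tens_cat s1 s2 s3 s4 :
    tens_eqv s1 s2 -> tens_eqv s3 s4 -> tens_eqv (s1 ++ s3) (s2 ++ s4)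
| tens_catC s1 s2 : tens_eqv (s1 ++ s2) (s2 ++ s1)
| tens_zero b : tens_eqv [:: (0, b)] [::]
| tens_addl a a' b : tens_eqv [:: (a + a', b)] [:: (a, b); (a', b)]
| tens_addr a b b' : tens_eqv [:: (a, b + b')] [:: (a, b); (a, b')]
| tens_scal r a b : tens_eqv [:: (r *: a, b)] [:: (a, r *: b)].

Definition tens_eqb : rel (seq (A * B)) := fun s1 s2 => `[< tens_eqv s1 s2 >].

Lemma tens_eqb_refl : reflexive tens_eqb.
Proof. by move=> s; apply/asboolP; apply: tens_refl. Qed.

Lemma tens_eqb_sym : symmetric tens_eqb.
Proof. by move=> s1 s2; apply/asboolP/asboolP; apply: tens_sym. Qed.

Lemma tens_eqb_trans : transitive tens_eqb.
Proof.
by move=> s2 s1 s3 /asboolP h1 /asboolP h2; apply/asboolP; apply: tens_trans h2.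
Qed.

Canonical tens_equiv := EquivRel tens_eqb tens_eqb_refl tens_eqb_sym tens_eqb_trans.

Definition tens := {eq_quot tens_equiv}.
HB.instance Definition _ := Choice.copy tens {eq_quot tens_equiv}.

Definition tens_pi s : tens := \pi_{eq_quot tens_equiv} s.
Definition tens_repr (x : tens) : seq (A * B) :=
  repr (x : {eq_quot tens_equiv}).

Lemma tens_reprK x : tens_pi (tens_repr x) = x.
Proof. exact: reprK. Qed.

Lemma tens_piP s1 s2 : tens_pi s1 = tens_pi s2 <-> tens_eqv s1 s2.
Proof.
split; first by move/eqmodP => /= /asboolP.
by move=> h; apply/eqmodP; apply/asboolP.
Qed.

Lemma tens_piK s : tens_eqv (tens_repr (tens_pi s)) s.
Proof. by apply/tens_piP; rewrite tens_reprK. Qed.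

Definition tens0 := tens_pi [::].
Definition tensD x y := tens_pi (tens_repr x ++ tens_repr y).
Definition tensZ (r : R) x :=
  tens_pi [seq (r *: p.1, p.2) | p <- tens_repr x].
Definition tensN x := tens_pi [seq (- p.1, p.2) | p <- tens_repr x].

Lemma tens_piD s1 s2 : tensD (tens_pi s1) (tens_pi s2) = tens_pi (s1 ++ s2).
Proof. by apply/tens_piP; apply: tens_cat; apply: tens_piK. Qed.

Lemma tens_eqv_map (r : R) s1 s2 : tens_eqv s1 s2 ->
  tens_eqv [seq (r *: p.1, p.2) | p <- s1] [seq (r *: p.1, p.2) | p <- s2].
Proof.
elim=> {s1 s2} [s|s1 s2 _|s1 s2 s3 _ h1 _ h2|s1 s2 s3 s4 _ h1 _ h2|s1 s2|b|a a' b
  |a b b'|r' a b] /=.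
- exact: tens_refl.
- exact: tens_sym.
- exact: tens_trans h2.
- by rewrite !map_cat; apply: tens_cat.
- by rewrite !map_cat; apply: tens_catC.
- by rewrite scaler0; apply: tens_zero.
- by rewrite scalerDr; apply: tens_addl.
- exact: tens_addr.
- by rewrite scalerA mulrC -scalerA; apply: tens_scal.
Qed.

Lemma tens_piZ r s : tensZ r (tens_pi s) = tens_pi [seq (r *: p.1, p.2) | p <- s].
Proof. by apply/tens_piP; apply: tens_eqv_map; apply: tens_piK. Qed.

Lemma tensN_Z x : tensN x = tensZ (-1) x.
Proof. by congr tens_pi; apply: eq_map => p; rewrite scaleN1r. Qed.

Lemma tensDA : associative tensD.
Proof.
move=> x y z; rewrite -[x]tens_reprK -[y]tens_reprK -[z]tens_reprK.
by rewrite !tens_piD catA.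
Qed.

Lemma tensDC : commutative tensD.
Proof.
move=> x y; rewrite -[x]tens_reprK -[y]tens_reprK !tens_piD.
by apply/tens_piP; apply: tens_catC.
Qed.

Lemma tens0D : left_id tens0 tensD.
Proof. by move=> x; rewrite -[x]tens_reprK /tens0 tens_piD. Qed.

Lemma tensZ_Dl x r r' : tensZ (r + r') x = tensD (tensZ r x) (tensZ r' x).
Proof.
rewrite -[x]tens_reprK; move: (tens_repr x) => s; rewrite !tens_piZ tens_piD.
apply/tens_piP; elim: s => [|p s IH] /=; first exact: tens_refl.
rewrite scalerDl.
have h := tens_cat (tens_addl (r *: p.1) (r' *: p.1) p.2) IH.
apply: (tens_trans h) => /=.
set u := map _ s; set v := map _ s.
have -> : [:: (r *: p.1, p.2), (r' *: p.1, p.2) & u ++ v] =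
  [:: (r *: p.1, p.2)] ++ ([:: (r' *: p.1, p.2)] ++ u) ++ v by [].
have -> : (r *: p.1, p.2) :: u ++ (r' *: p.1, p.2) :: v =
  [:: (r *: p.1, p.2)] ++ (u ++ [:: (r' *: p.1, p.2)]) ++ v.
  by rewrite -catA.
apply: tens_cat; first exact: tens_refl.
by apply: tens_cat; [apply: tens_catC | apply: tens_refl].
Qed.

Lemma tensZ0 x : tensZ 0 x = tens0.
Proof.
rewrite -[x]tens_reprK; move: (tens_repr x) => s; rewrite tens_piZ.
apply/tens_piP; elim: s => [|p s IH] /=; first exact: tens_refl.
by rewrite scale0r; apply: (tens_cat (tens_zero p.2) IH).
Qed.

Lemma tensZ1 : left_id 1 tensZ.
Proof.
move=> x; rewrite /tensZ -[RHS]tens_reprK; congr tens_pi.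
by rewrite -[RHS]map_id; apply: eq_map => -[a b]; rewrite scale1r.
Qed.

Lemma tensND : left_inverse tens0 tensN tensD.
Proof. by move=> x; rewrite tensN_Z -{2}[x]tensZ1 -tensZ_Dl addNr tensZ0. Qed.

HB.instance Definition _ := GRing.isZmodule.Build tens tensDA tensDC tens0D tensND.

Lemma tensZA r r' x : tensZ r (tensZ r' x) = tensZ (r * r') x.
Proof.
rewrite -[x]tens_reprK !tens_piZ -map_comp; congr tens_pi.
by apply: eq_map => p /=; rewrite scalerA.
Qed.

Lemma tensZDr : right_distributive tensZ +%R.
Proof.
move=> r x y; rewrite -[x]tens_reprK -[y]tens_reprK.
by rewrite [_ + _]tens_piD !tens_piZ map_cat [in RHS]/+%R/= tens_piD.
Qed.

HB.instance Definition _ :=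
  GRing.Zmodule_isLmodule.Build R tens tensZA tensZ1 tensZDr tensZ_Dl.

Definition tpure (a : A) (b : B) : tens := tens_pi [:: (a, b)].

Lemma tens_piE s : tens_pi s = \sum_(p <- s) tpure p.1 p.2.
Proof.
elim: s => [|[a b] s IH]; first by rewrite big_nil.
by rewrite big_cons -IH /= [in RHS]/+%R/= tens_piD.
Qed.

Lemma tensE x : x = \sum_(p <- tens_repr x) tpure p.1 p.2.
Proof. by rewrite -tens_piE tens_reprK. Qed.

Lemma tpureDl a a' b : tpure (a + a') b = tpure a b + tpure a' b.
Proof. by rewrite [RHS]tens_piD; apply/tens_piP; apply: tens_addl. Qed.

Lemma tpureDr a b b' : tpure a (b + b') = tpure a b + tpure a b'.
Proof. by rewrite [RHS]tens_piD; apply/tens_piP; apply: tens_addr. Qed.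

Lemma tpure0l b : tpure 0 b = 0.
Proof. by apply: (addrI (tpure 0 b)); rewrite -tpureDl !addr0. Qed.

Lemma tpure0r a : tpure a 0 = 0.
Proof. by apply: (addrI (tpure a 0)); rewrite -tpureDr !addr0. Qed.

Lemma tpure_suml (I : Type) (r : seq I) (P : pred I) (G : I -> A) b :
  tpure (\sum_(i <- r | P i) G i) b = \sum_(i <- r | P i) tpure (G i) b.
Proof. exact: (big_morph (tpure^~ b) (fun a a' => tpureDl a a' b) (tpure0l b)). Qed.

Lemma tpure_sumr (I : Type) (r : seq I) (P : pred I) a (G : I -> B) :
  tpure a (\sum_(i <- r | P i) G i) = \sum_(i <- r | P i) tpure a (G i).
Proof. exact: (big_morph (tpure a) (tpureDr a) (tpure0r a)). Qed.

Lemma tpure_bal r a b : tpure (r *: a) b = tpure a (r *: b).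
Proof. by apply/tens_piP; apply: tens_scal. Qed.

Lemma tpureZl r a b : tpure (r *: a) b = r *: tpure a b.
Proof. by rewrite [RHS]tens_piZ. Qed.

Lemma tpureZr r a b : tpure a (r *: b) = r *: tpure a b.
Proof. by rewrite -tpure_bal tpureZl. Qed.

Definition balanced (C : zmodType) (phi : A -> B -> C) :=
  [/\ forall a a' b, phi (a + a') b = phi a b + phi a' b,
      forall a b b', phi a (b + b') = phi a b + phi a b'
    & forall r a b, phi (r *: a) b = phi a (r *: b)].

(* The additive map sending a (x) b to phi a b; meaningful for balanced phi. *)
Definition tlift (C : zmodType) (phi : A -> B -> C) (x : tens) : C :=
  \sum_(p <- tens_repr x) phi p.1 p.2.

Section Lift.
Variables (C : zmodType) (phi : A -> B -> C).
Hypothesis hphi : balanced phi.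

Lemma tlift_pi s : tlift phi (tens_pi s) = \sum_(p <- s) phi p.1 p.2.
Proof.
case: hphi => hl hr hb.
have h0 b : phi 0 b = 0 by apply: (addrI (phi 0 b)); rewrite -hl !addr0.
suff H s1 s2 : tens_eqv s1 s2 ->
    \sum_(p <- s1) phi p.1 p.2 = \sum_(p <- s2) phi p.1 p.2.
  exact: H (tens_piK s).
elim=> {s s1 s2} //=.
- by move=> s1 s2 s3 _ -> _ ->.
- by move=> s1 s2 s3 s4 _ h1 _ h2; rewrite !big_cat /= h1 h2.
- by move=> s1 s2; rewrite !big_cat /= addrC.
- by move=> b; rewrite big_seq1 big_nil h0.
- by move=> a a' b; rewrite !big_cons !big_nil /= !addr0 hl.
- by move=> a b b'; rewrite !big_cons !big_nil /= !addr0 hr.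
- by move=> r a b; rewrite !big_seq1 /= hb.
Qed.

Lemma tlift_pure a b : tlift phi (tpure a b) = phi a b.
Proof. by rewrite tlift_pi big_seq1. Qed.

Lemma tliftD x y : tlift phi (x + y) = tlift phi x + tlift phi y.
Proof.
rewrite -[x]tens_reprK -[y]tens_reprK [_ + _]tens_piD !tlift_pi.
by rewrite big_cat.
Qed.

Lemma tlift0 : tlift phi 0 = 0.
Proof. by apply: (addrI (tlift phi 0)); rewrite -tliftD !addr0. Qed.

Lemma tlift_sum (I : Type) (r : seq I) (P : pred I) (G : I -> tens) :
  tlift phi (\sum_(i <- r | P i) G i) = \sum_(i <- r | P i) tlift phi (G i).
Proof. exact: (big_morph _ tliftD tlift0). Qed.

End Lift.

Lemma tens_ext (C : zmodType) (f g : tens -> C) :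
  {morph f : x y / x + y} -> {morph g : x y / x + y} ->
  (forall a b, f (tpure a b) = g (tpure a b)) -> f =1 g.
Proof.
move=> fD gD fg x; rewrite [x]tensE.
have f0 : f 0 = 0 by apply: (addrI (f 0)); rewrite -fD !addr0.
have g0 : g 0 = 0 by apply: (addrI (g 0)); rewrite -gD !addr0.
rewrite (big_morph _ fD f0) (big_morph _ gD g0).
by apply: eq_bigr => p _; apply: fg.
Qed.

End Tensor.

Definition tmap (R : comNzRingType) (A B A' B' : lmodType R)
    (f : A -> A') (g : B -> B') : tens A B -> tens A' B' :=
  tlift (fun a b => tpure (f a) (g b)).

Definition tswap (R : comNzRingType) (A : lmodType R) : tens A A -> tens A A :=
  tlift (fun a b => tpure b a).

Definition symmetric_tensors (R : comNzRingType) (A : lmodType R) : set (tens A A) :=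
  [set z | tswap z = z].

(* F[[t]]; the series sum_k p_k t^k is the function k |-> p_k. *)

Section PowerSeries.
Variable F : fieldType.

Definition pseries := nat -> F.
HB.instance Definition _ := gen_eqMixin pseries.
HB.instance Definition _ := gen_choiceMixin pseries.

Implicit Types p q : pseries.

Definition ps0 : pseries := fun=> 0.
Definition psC (a : F) : pseries := fun k => if k == 0%N then a else 0.
Definition psD p q : pseries := fun k => p k + q k.
Definition psN p : pseries := fun k => - p k.
Definition psM p q : pseries := fun k => \sum_(i < k.+1) p i * q (k - i)%N.

Lemma psDA : associative psD.
Proof. by move=> p q r; apply/funext => k; apply: addrA. Qed.
Lemma psDC : commutative psD.
Proof. by move=> p q; apply/funext => k; apply: addrC. Qed.
Lemma ps0D : left_id ps0 psD.
Proof. by move=> p; apply/funext => k; apply: add0r. Qed.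
Lemma psND : left_inverse ps0 psN psD.
Proof. by move=> p; apply/funext => k; apply: addNr. Qed.

HB.instance Definition _ := GRing.isZmodule.Build pseries psDA psDC ps0D psND.

Lemma psMA : associative psM.
Proof.
move=> p q r; apply/funext => k; rewrite /psM.
under eq_bigr => i _ do rewrite -subSn ?big_distrr//= -1?ltnS //.
rewrite (triangular_sum (fun i j => p i * (q j * r (k - i - j)%N))).
apply: eq_bigr => l _; rewrite big_distrl /=; apply: eq_bigr => i _.
by rewrite mulrA -subnDA subnKC // -ltnS.
Qed.

Lemma psMC : commutative psM.
Proof.
move=> p q; apply/funext => k; rewrite /psM (reindex_inj rev_ord_inj) /=.
apply: eq_bigr => i _; rewrite subSS mulrC; congr (q _ * _).
by rewrite subKn // -ltnS.
Qed.

Lemma ps1M : left_id (psC 1) psM.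
Proof.
move=> p; apply/funext => k; rewrite /psM big_ord_recl /= mul1r subn0.
by rewrite big1 ?addr0 // => i _; rewrite /psC /= mul0r.
Qed.

Lemma psMDl : left_distributive psM psD.
Proof.
move=> p q r; apply/funext => k; rewrite /psM /psD -big_split /=.
by apply: eq_bigr => i _; rewrite mulrDl.
Qed.

Lemma ps1_neq0 : psC 1 != ps0.
Proof. by apply/eqP => /(congr1 (@^~ 0%N))/eqP; rewrite /psC /= oner_eq0. Qed.

HB.instance Definition _ :=
  GRing.Zmodule_isComNzRing.Build pseries psMA psMC ps1M psMDl ps1_neq0.

Lemma psC_is_additive a b : psC (a + b) = psC a + psC b.
Proof. by apply/funext => -[|k] //=; rewrite /+%R /= /psD /= addr0. Qed.

Lemma psCM a b : psC (a * b) = psC a * psC b.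
Proof.
apply/funext => k; rewrite [RHS]/(psM _ _ _) big_ord_recl /= subn0 big1.
  by rewrite addr0 /psC; case: eqP => // _; rewrite mulr0.
by move=> i _; rewrite mul0r.
Qed.

(* V (x)_F F[[t]], as V is finite-dimensional: series with coefficients in V.   *)

Variable V : vectType F.

Definition vseries := nat -> V.
HB.instance Definition _ := gen_eqMixin vseries.
HB.instance Definition _ := gen_choiceMixin vseries.

Implicit Types v w : vseries.

Definition vs0 : vseries := fun=> 0.
Definition vsC (a : V) : vseries := fun k => if k == 0%N then a else 0.
Definition vsD v w : vseries := fun k => v k + w k.
Definition vsN v : vseries := fun k => - v k.
Definition vsZ p v : vseries := fun k => \sum_(i < k.+1) p i *: v (k - i)%N.

Lemma vsDA : associative vsD.
Proof. by move=> p q r; apply/funext => k; apply: addrA. Qed.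
Lemma vsDC : commutative vsD.
Proof. by move=> p q; apply/funext => k; apply: addrC. Qed.
Lemma vs0D : left_id vs0 vsD.
Proof. by move=> p; apply/funext => k; apply: add0r. Qed.
Lemma vsND : left_inverse vs0 vsN vsD.
Proof. by move=> p; apply/funext => k; apply: addNr. Qed.

HB.instance Definition _ := GRing.isZmodule.Build vseries vsDA vsDC vs0D vsND.

Lemma vsZA p q v : vsZ p (vsZ q v) = vsZ (p * q) v.
Proof.
apply/funext => k; rewrite /vsZ.
under eq_bigr => i _ do rewrite -subSn ?scaler_sumr//= -1?ltnS //.
rewrite (triangular_sum (fun i j => p i *: (q j *: v (k - i - j)%N))).
apply: eq_bigr => l _; rewrite scaler_suml /=; apply: eq_bigr => i _.
by rewrite scalerA -subnDA subnKC // -ltnS.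
Qed.

Lemma vsZ1 : left_id 1 vsZ.
Proof.
move=> v; apply/funext => k; rewrite /vsZ big_ord_recl /= scale1r subn0.
by rewrite big1 ?addr0 // => i _; rewrite scale0r.
Qed.

Lemma vsZDr : right_distributive vsZ +%R.
Proof.
move=> p v w; apply/funext => k; rewrite [RHS]/(vsD _ _ _) /vsZ -big_split /=.
by apply: eq_bigr => i _; rewrite scalerDr.
Qed.

Lemma vsZDl v : {morph vsZ^~ v : p q / p + q}.
Proof.
move=> p q; apply/funext => k; rewrite [RHS]/(vsD _ _ _) /vsZ -big_split /=.
by apply: eq_bigr => i _; rewrite scalerDl.
Qed.

HB.instance Definition _ :=
  GRing.Zmodule_isLmodule.Build pseries vseries vsZA vsZ1 vsZDr vsZDl.

Variable b : {symmetric V}.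

(* The coefficients of the F[[t]]-bilinear extension of b to V[[t]]. *)
Definition vform v w : pseries :=
  fun k => \sum_(i < k.+1) b (v i) (w (k - i)%N).

Lemma symmC (u v : V) : b u v = b v u.
Proof. by rewrite hermC expr0 mul1r. Qed.

Lemma vformC v w : vform v w = vform w v.
Proof.
apply/funext => k; rewrite /vform (reindex_inj rev_ord_inj) /=.
apply: eq_bigr => i _; rewrite subSS symmC; congr (b (w _) _).
by rewrite subKn // -ltnS.
Qed.

Lemma vformDl v v' w : vform (v + v') w = vform v w + vform v' w.
Proof.
apply/funext => k; rewrite [RHS]/(psD _ _ _) /vform -big_split /=.
by apply: eq_bigr => i _; rewrite linearDl.
Qed.

Lemma vformZl p v w : vform (p *: v) w = p * vform v w.
Proof.
apply/funext => k; rewrite [RHS]/(psM _ _ _) /vform.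
under [RHS]eq_bigr => i _ do rewrite -subSn ?mulr_sumr//= -1?ltnS //.
rewrite (triangular_sum (fun i j => p i * (b (v j) (w (k - i - j)%N)))).
apply: eq_bigr => l _; rewrite linear_sumlz; apply: eq_bigr => i _.
by rewrite linearZl_LR -subnDA subnKC // -ltnS.
Qed.

Lemma vformDr v w w' : vform v (w + w') = vform v w + vform v w'.
Proof. by rewrite vformC vformDl !(vformC v). Qed.

Lemma vformZr p v w : vform v (p *: w) = p * vform v w.
Proof. by rewrite vformC vformZl vformC. Qed.

Lemma vform_vsC (u v : V) : vform (vsC u) (vsC v) = psC (b u v).
Proof.
apply/funext => -[|k]; rewrite /vform.
  by rewrite big_ord_recl big_ord0 addr0 /= /vsC.
rewrite big_ord_recl /= big1; first by rewrite addr0 linear0r.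
by move=> i _; rewrite linear0l.
Qed.

(* G(F[[t]]) for G = O(V, b): the F[[t]]-linear automorphisms of V[[t]] that     *)
(* preserve the extended form. The orbits do not depend on whether g is read as *)
(* acting from the left or from the right.                                      *)
Definition orthogonal_Ft : set {linear vseries -> vseries} :=
  [set g : {linear vseries -> vseries} |
    bijective g /\ forall v w, vform (g v) (g w) = vform v w].

End PowerSeries.

Arguments psC {F}.
Arguments vsC {F V}.

Record ntModule (F : fieldType) := NtModule {
  nt_space :> vectType F;
  nt_t : 'End(nt_space);
  nt_nilp : exists n, forall u, iter n nt_t u = 0
}.

Record sntModule (F : fieldType) := SntModule {
  snt_nt :> ntModule F;
  snt_form : {skew_symmetric nt_space snt_nt};
  snt_symplectic : is_psymplectic snt_form;
  snt_adj : forall xi eta,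
    snt_form (nt_t snt_nt xi) eta = snt_form xi (nt_t snt_nt eta)
}.

Section NtModule.
Variables (F : fieldType) (M : ntModule F).
Implicit Types (p q : pseries F) (u v : M).

Definition nt_idx : nat := projT1 (cid (nt_nilp M)).

Lemma nt_pow0 n u : (nt_idx <= n)%N -> iter n (nt_t M) u = 0.
Proof.
move=> /subnK <-; rewrite iterD (projT2 (cid (nt_nilp M))).
by elim: (_ - _)%N => //= k ->; rewrite linear0.
Qed.

Lemma nt_powD n u v :
  iter n (nt_t M) (u + v) = iter n (nt_t M) u + iter n (nt_t M) v.
Proof. by elim: n => //= n ->; rewrite linearD. Qed.

Lemma nt_powZ n (a : F) u : iter n (nt_t M) (a *: u) = a *: iter n (nt_t M) u.
Proof. by elim: n => //= n ->; rewrite linearZ. Qed.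

Lemma nt_pow_sum n (I : Type) (r : seq I) (P : pred I) (G : I -> M) :
  iter n (nt_t M) (\sum_(i <- r | P i) G i) =
  \sum_(i <- r | P i) iter n (nt_t M) (G i).
Proof.
apply: (big_morph (iter n (nt_t M)) (nt_powD n)).
by elim: n => //= n ->; rewrite linear0.
Qed.

(* The action of F[[t]] on M: since t^nt_idx = 0, the sum over all k stops there. *)
Definition nt_act p u : M := \sum_(k < nt_idx) p k *: iter k (nt_t M) u.

Lemma nt_actE n p u : (nt_idx <= n)%N ->
  nt_act p u = \sum_(k < n) p k *: iter k (nt_t M) u.
Proof.
move=> le_n; rewrite /nt_act (big_ord_widen n (fun k => p k *: iter k (nt_t M) u)) //.
rewrite big_mkcond /=; apply: eq_bigr => k _; case: ltnP => // /nt_pow0 ->.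
by rewrite scaler0.
Qed.

Lemma nt_actA p q u : nt_act p (nt_act q u) = nt_act (p * q) u.
Proof.
transitivity (\sum_(i < nt_idx) \sum_(j < nt_idx)
    p i *: (q j *: iter (i + j) (nt_t M) u)).
  apply: eq_bigr => i _; rewrite /nt_act nt_pow_sum scaler_sumr.
  by apply: eq_bigr => j _; rewrite nt_powZ -iterD.
rewrite (square_sum (G := fun i j => p i *: (q j *: iter (i + j) (nt_t M) u))).
  2: by move=> i j /nt_pow0 ->; rewrite !scaler0.
apply: eq_bigr => l _; rewrite [(p * q) l]/(psM _ _ _) scaler_suml.
by apply: eq_bigr => i _; rewrite scalerA subnKC // -ltnS.
Qed.

Lemma nt_act1 u : nt_act 1 u = u.
Proof.
rewrite (nt_actE (n := nt_idx.+1)) // big_ord_recl /= scale1r big1 ?addr0 //.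
by move=> i _; rewrite scale0r.
Qed.

Lemma nt_actDr p u v : nt_act p (u + v) = nt_act p u + nt_act p v.
Proof.
by rewrite -big_split /=; apply: eq_bigr => i _; rewrite nt_powD scalerDr.
Qed.

Lemma nt_actDl p q u : nt_act (p + q) u = nt_act p u + nt_act q u.
Proof.
by rewrite -big_split /=; apply: eq_bigr => i _; rewrite scalerDl.
Qed.

Lemma nt_actC (a : F) u : nt_act (psC a) u = a *: u.
Proof.
rewrite (nt_actE (n := nt_idx.+1)) // big_ord_recl /= big1 ?addr0 //.
by move=> i _; rewrite scale0r.
Qed.

Definition psX (n : nat) : pseries F := fun k => (k == n)%:R.

Lemma psX0 : psX 0 = 1.
Proof. by apply/funext => -[]. Qed.

Lemma psXD n m : psX (n + m) = psX n * psX m.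
Proof.
apply/funext => k; rewrite [RHS]/(psM _ _ _) /psX.
have [le_nk|lt_kn] := leqP n k; last first.
  rewrite big1 => [|i _]; last first.
    by rewrite ltn_eqF ?mul0r // (leq_trans (ltn_ord i)).
  by rewrite ltn_eqF // (leq_trans lt_kn) ?leq_addr.
rewrite (bigD1 (Ordinal (le_nk : n < k.+1)%N)) //= eqxx mul1r big1 ?addr0.
  by rewrite -(eqn_add2l n (k - n)) subnKC.
by move=> i; rewrite -val_eqE /= => /negbTE ->; rewrite mul0r.
Qed.

Lemma nt_actX n u : nt_act (psX n) u = iter n (nt_t M) u.
Proof.
rewrite (nt_actE (n := nt_idx + n.+1)) ?leq_addr //.
have lt_n : (n < nt_idx + n.+1)%N by rewrite addnS ltnS leq_addl.
rewrite (bigD1 (Ordinal lt_n)) //= /psX eqxx scale1r big1 ?addr0 // => i.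
by rewrite -val_eqE /= => /negbTE ->; rewrite scale0r.
Qed.

(* An F[[t]]-submodule of M is in particular an F-subspace. *)
Record submod := Submod {
  submod_space :> {vspace M};
  _ : `[< forall p u, u \in submod_space -> nt_act p u \in submod_space >]
}.
HB.instance Definition _ := [isSub for submod_space].

Lemma submodP (W : submod) p u : u \in (W : {vspace M}) -> nt_act p u \in (W : {vspace M}).
Proof. by case: W => W /= /asboolP; apply. Qed.

Definition Gr (L : submod) : set submod := [set W | (W <= L)%VS].

(* The elements of W, as an F[[t]]-module; subvs_of W is the underlying F-space. *)
Definition submod_Ft (W : submod) := subvs_of W.

Section SubmodFt.
Variable W : submod.

HB.instance Definition _ := GRing.Zmodule.copy (submod_Ft W) (subvs_of W).

Definition submod_act p (w : submod_Ft W) : submod_Ft W := vsproj W (nt_act p (vsval w)).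

Lemma val_submod_act p (w : submod_Ft W) :
  vsval (submod_act p w) = nt_act p (vsval w).
Proof. by rewrite vsprojK // submodP // subvsP. Qed.

Lemma submod_actA p q w : submod_act p (submod_act q w) = submod_act (p * q) w.
Proof. by apply: val_inj; rewrite /= !val_submod_act nt_actA. Qed.

Lemma submod_act1 : left_id 1 submod_act.
Proof. by move=> w; apply: val_inj; rewrite /= val_submod_act nt_act1. Qed.

Lemma submod_actDr : right_distributive submod_act +%R.
Proof. by move=> p u v; apply: val_inj; rewrite /= !val_submod_act nt_actDr. Qed.

Lemma submod_actDl w : {morph submod_act^~ w : p q / p + q}.
Proof. by move=> p q; apply: val_inj; rewrite /= !val_submod_act nt_actDl. Qed.

HB.instance Definition _ := GRing.Zmodule_isLmodule.Build (pseries F) (submod_Ft W)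
  submod_actA submod_act1 submod_actDr submod_actDl.

Lemma submod_actC (a : F) (w : submod_Ft W) :
  (psC a : pseries F) *: w = (a *: (w : subvs_of W) : subvs_of W).
Proof. by apply: val_inj; rewrite /= val_submod_act nt_actC. Qed.

Lemma submod_actX0 n (w : submod_Ft W) : (nt_idx <= n)%N -> psX n *: w = 0.
Proof. by move=> le_n; apply: val_inj; rewrite /= val_submod_act nt_actX nt_pow0. Qed.

Lemma submod_actE p (w : submod_Ft W) :
  p *: w = \sum_(k < nt_idx) (p k *: (psX k *: w : subvs_of W) : subvs_of W).
Proof.
apply: val_inj; rewrite /= val_submod_act raddf_sum /=.
by apply: eq_bigr => k _; rewrite val_submod_act nt_actX.
Qed.

End SubmodFt.
End NtModule.

Definition restrict_scalars (F : fieldType) (N : lmodType (pseries F)) : Type := N.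

Section RestrictScalars.
Variables (F : fieldType) (N : lmodType (pseries F)).
Local Notation RN := (restrict_scalars N).

HB.instance Definition _ := GRing.Zmodule.copy RN N.

Definition rs_scale (a : F) (z : RN) : RN := (psC a : pseries F) *: (z : N).

Lemma rs_scaleA a b z : rs_scale a (rs_scale b z) = rs_scale (a * b) z.
Proof. by rewrite /rs_scale scalerA psCM. Qed.
Lemma rs_scale1 : left_id 1 rs_scale.
Proof. by move=> z; rewrite /rs_scale [psC 1]/(1 : pseries F) scale1r. Qed.
Lemma rs_scaleDr : right_distributive rs_scale +%R.
Proof. by move=> a x y; apply: scalerDr. Qed.
Lemma rs_scaleDl z : {morph rs_scale^~ z : a b / a + b}.
Proof. by move=> a b; rewrite /rs_scale psC_is_additive scalerDl. Qed.

HB.instance Definition _ := GRing.Zmodule_isLmodule.Build F RN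
  rs_scaleA rs_scale1 rs_scaleDr rs_scaleDl.

End RestrictScalars.

(* The differential at x of a polynomial map T between F-vector spaces: L y is  *)
(* the coefficient of a in the expansion of T (x + a y) in powers of a. Over an *)
(* infinite field this determines L.                                            *)
Definition is_differential (F : fieldType) (A B : lmodType F) (T : A -> B) (x : A)
    (L : {linear A -> B}) :=
  forall y, exists c : seq B, forall a : F,
    T (x + a *: y) = T x + a *: L y + \sum_(k < size c) a ^+ k.+2 *: c`_k.

(* T is submersive at x as a map into the linear subspace S of B. *)
Definition submersive_at (F : fieldType) (A B : lmodType F) (S : set B)
    (T : A -> B) (x : A) :=
  exists2 L : {linear A -> B}, is_differential T x L & range L = S.

Section Moment.
Variables (F : fieldType) (M : ntModule F) (V : vectType F) (b : {symmetric V}).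

Section OneSubmodule.
Variable W : submod M.

(* W (x)_F V and W (x)_F[[t]] V[[t]], with the identification of the first      *)
(* with the second.                                                             *)
Definition tensF := tens (subvs_of W) V.
Definition tensFt := tens (submod_Ft W) (vseries V).

Definition to_Ft : tensF -> tensFt :=
  tlift (fun (u : subvs_of W) (v : V) => tpure (u : submod_Ft W) (vsC v : vseries V)).

Definition of_Ft : tensFt -> tensF :=
  tlift (fun (u : submod_Ft W) (w : vseries V) =>
    \sum_(k < nt_idx M) tpure (psX F k *: u : subvs_of W) (w k)).

Lemma to_Ft_bal :
  balanced (fun (u : subvs_of W) (v : V) => tpure (u : submod_Ft W) (vsC v : vseries V)).
Proof.
split=> [u u' v|u v v'|a u v]; first exact: tpureDl.
  rewrite -tpureDr; congr tpure; apply/funext => -[|k] //=.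
  by rewrite [RHS]/(vsD _ _ _) /vsD /= addr0.
rewrite -[a *: u]submod_actC tpure_bal; congr tpure; apply/funext => k.
rewrite [LHS]/(vsZ _ _ _) big_ord_recl /= subn0 big1 => [|i _].
  by rewrite addr0 /vsC; case: eqP => // _; rewrite scaler0.
by rewrite scale0r.
Qed.

Lemma of_Ft_bal : balanced (fun (u : submod_Ft W) (w : vseries V) =>
  \sum_(k < nt_idx M) tpure (psX F k *: u : subvs_of W) (w k)).
Proof.
split=> [u u' w|u w w'|p u w].
- by rewrite -big_split; apply: eq_bigr => k _; rewrite scalerDr; apply: tpureDl.
- by rewrite -big_split; apply: eq_bigr => k _; apply: tpureDr.
pose G i j : tensF := tpure (psX F (i + j) *: u : subvs_of W) (p i *: w j).
transitivity (\sum_(i < nt_idx M) \sum_(j < nt_idx M) G i j).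
  rewrite exchange_big /=; apply: eq_bigr => j _.
  rewrite scalerA mulrC -scalerA submod_actE tpure_suml.
  by apply: eq_bigr => i _; rewrite tpure_bal scalerA -psXD.
rewrite (square_sum (G := G)).
  2: by move=> i j le_n; rewrite /G submod_actX0 // tpure0l.
apply: eq_bigr => l _; rewrite [(p *: w) l]/(vsZ _ _ _) tpure_sumr.
by apply: eq_bigr => i _; rewrite /G subnKC // -ltnS.
Qed.

Lemma to_FtK : cancel to_Ft of_Ft.
Proof.
apply: (@tens_ext _ _ _ _ (of_Ft \o to_Ft) id) => [x y|x y|u v] //=.
  by rewrite /of_Ft /to_Ft (tliftD to_Ft_bal) (tliftD of_Ft_bal).
rewrite /of_Ft /to_Ft (tlift_pure to_Ft_bal) (tlift_pure of_Ft_bal).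
have uE : (psX F 0 *: (u : submod_Ft W)) = u by rewrite psX0 scale1r.
case E: (nt_idx M) => [|n].
  rewrite big_ord0 -[u](_ : psX F 0 *: (u : submod_Ft W) = u) //.
  by rewrite submod_actX0 ?E // tpure0l.
rewrite big_ord_recl /= uE /vsC /= big1 ?addr0 // => i _.
by rewrite tpure0r.
Qed.

Lemma vs_shift n (w : vseries V) :
  w = \sum_(k < n) psX F k *: (vsC (w k) : vseries V)
      + psX F n *: ((fun k => w (k + n)%N) : vseries V).
Proof.
elim: n => [|n {1}->].
  rewrite big_ord0 add0r psX0 scale1r; apply/funext => k /=.
  by rewrite addn0.
rewrite big_ord_recr /= -addrA; congr (_ + _).
rewrite -addn1 psXD -scalerA -scalerDr; congr (_ *: _).
apply/funext => k; rewrite [RHS]/(vsD _ _ _) /vsD [X in _ + X]/(vsZ _ _ _).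
case: k => [|k]; first by rewrite big_ord_recl big_ord0 scale0r !addr0.
rewrite [vsC _ _]/= add0r 2!big_ord_recl /= scale0r add0r scale1r big1 ?addr0.
  by rewrite subSS subn0 addnA addnAC addn1 addSn.
by move=> i _; rewrite scale0r.
Qed.

Lemma of_FtK : cancel of_Ft to_Ft.
Proof.
apply: (@tens_ext _ _ _ _ (to_Ft \o of_Ft) id) => [x y|x y|u w] //=.
  by rewrite /of_Ft /to_Ft (tliftD of_Ft_bal) (tliftD to_Ft_bal).
rewrite /of_Ft /to_Ft (tlift_pure of_Ft_bal) (tlift_sum to_Ft_bal).
rewrite [in RHS](vs_shift (nt_idx M) w) tpureDr -[tpure _ (psX _ _ *: _)]tpure_bal.
rewrite submod_actX0 // tpure0l addr0 tpure_sumr; apply: eq_bigr => k _.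
by rewrite (tlift_pure to_Ft_bal) tpure_bal.
Qed.

(* f_x, for x = sum_i u_i (x) v_i, is v |-> sum_i (v_i, v) u_i. *)
Definition f_Ft (x : tensFt) (v : vseries V) : submod_Ft W :=
  tlift (fun (u : submod_Ft W) (w : vseries V) => vform b w v *: u) x.
Definition f_ (x : tensF) : vseries V -> submod_Ft W := f_Ft (to_Ft x).

Lemma f_Ft_bal v :
  balanced (fun (u : submod_Ft W) (w : vseries V) => vform b w v *: u).
Proof.
split=> [u u' w|u w w'|p u w]; first exact: scalerDr.
  by rewrite vformDl scalerDl.
by rewrite vformZl mulrC scalerA.
Qed.

Lemma f_E (I : Type) (r : seq I) (u : I -> subvs_of W) (v : I -> V) (w : vseries V) :
  f_ (\sum_(i <- r) tpure (u i) (v i)) w =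
  \sum_(i <- r) vform b (vsC (v i)) w *: (u i : submod_Ft W).
Proof.
rewrite /f_ /f_Ft /to_Ft (tlift_sum to_Ft_bal) (tlift_sum (f_Ft_bal w)).
by apply: eq_bigr => i _; rewrite (tlift_pure to_Ft_bal) (tlift_pure (f_Ft_bal w)).
Qed.

(* The action of g on W (x)_F V through the second factor of W (x)_F[[t]] V[[t]]. *)
Definition act_Ft (g : {linear vseries V -> vseries V}) (x : tensF) : tensF :=
  of_Ft (tmap id g (to_Ft x)).

Definition orbit_Ft (x : tensF) : set tensF :=
  [set act_Ft g x | g in orthogonal_Ft b].

Definition orbits_Ft : set (set tensF) := range orbit_Ft.

Definition tens2 := tens (submod_Ft W) (submod_Ft W).

Definition S2t : set tens2 := @symmetric_tensors _ (submod_Ft W).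

(* T_W, for x = sum_i w_i (x) v_i, is sum_(i, j) (v_i, v_j) w_i (x) w_j. *)
Definition T_ (x : tensF) : restrict_scalars tens2 :=
  tlift (fun (w : subvs_of W) (v : V) => tlift (fun (w' : subvs_of W) (v' : V) =>
    psC (b v v') *: tpure (w : submod_Ft W) (w' : submod_Ft W)) x) x.

Lemma T_inner_bal (w : subvs_of W) (v : V) :
  balanced (fun (w' : subvs_of W) (v' : V) =>
    psC (b v v') *: tpure (w : submod_Ft W) (w' : submod_Ft W)).
Proof.
split=> [w1 w2 v'|w' v1 v2|a w' v'].
- by rewrite -scalerDr -tpureDr.
- by rewrite linearDr psC_is_additive scalerDl.
by rewrite -submod_actC tpureZr scalerA linearZr_LR /= psCM mulrC.
Qed.

Lemma T_outer_bal x : balanced (fun (w : subvs_of W) (v : V) =>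
  tlift (fun (w' : subvs_of W) (v' : V) =>
    psC (b v v') *: tpure (w : submod_Ft W) (w' : submod_Ft W)) x).
Proof.
split=> [w1 w2 v|w v1 v2|a w v]; rewrite /tlift -?big_split; apply: eq_bigr => p _ /=.
- by rewrite -scalerDr -tpureDl.
- by rewrite linearDl psC_is_additive scalerDl.
by rewrite -submod_actC tpureZl scalerA linearZl_LR /= psCM mulrC.
Qed.

Lemma T_E (I : Type) (r : seq I) (w : I -> subvs_of W) (v : I -> V) :
  T_ (\sum_(i <- r) tpure (w i) (v i)) =
  \sum_(i <- r) \sum_(j <- r)
     psC (b (v i) (v j)) *: tpure (w i : submod_Ft W) (w j : submod_Ft W).
Proof.
rewrite /T_ (tlift_sum (T_outer_bal _)); apply: eq_bigr => i _.
rewrite (tlift_pure (T_outer_bal _)) (tlift_sum (T_inner_bal _ _)).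
by apply: eq_bigr => j _; rewrite (tlift_pure (T_inner_bal _ _)).
Qed.

Lemma T_S2t x : S2t (T_ x).
Proof.
have swap_bal : balanced (fun a c : submod_Ft W => tpure c a).
  split=> *; [exact: tpureDr | exact: tpureDl | by rewrite tpure_bal].
have swapZ p (z : tens2) : tswap (p *: z) = p *: tswap z.
  apply: (@tens_ext _ _ _ _ (fun z => tswap (p *: z)) (fun z => p *: tswap z)) => {z}.
  - by move=> y z; rewrite scalerDr [LHS](tliftD swap_bal).
  - by move=> y z; rewrite -scalerDr; congr (_ *: _); apply: (tliftD swap_bal).
  - by move=> u v; rewrite -tpureZl /tswap !(tlift_pure swap_bal) tpureZr.
rewrite /S2t /symmetric_tensors /= [x]tensE T_E /tswap (tlift_sum swap_bal).
under eq_bigr => i _ do rewrite (tlift_sum swap_bal).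
rewrite exchange_big /=; apply: eq_bigr => i _; apply: eq_bigr => j _.
by rewrite [tlift _ _]swapZ symmC; congr (_ *: _); apply: (tlift_pure swap_bal).
Qed.

(* U(i)_F. The target S_t^2(W) is an F-vector space, so it is its own tangent   *)
(* space, and at an F-point submersivity is surjectivity of the F-linear        *)
(* differential.                                                                *)
Definition U_F (i : tens2) : set tensF :=
  [set x | T_ x = i /\ @submersive_at F tensF (restrict_scalars tens2) S2t T_ x].

End OneSubmodule.

(* The map induced by the inclusion of W in L; meaningful for W <= L. *)
Definition tens_incl (W L : submod M) : tensF W -> tensF L :=
  tmap (fun w : subvs_of W => vsproj L (vsval w)) id.

Lemma tens_incl_bal (W L : submod M) :
  balanced (fun (w : subvs_of W) (v : V) => tpure (vsproj L (vsval w)) (id v)).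
Proof.
split=> [w w' v|w v v'|a w v].
- by rewrite !linearD tpureDl.
- exact: tpureDr.
by rewrite !linearZ tpure_bal.
Qed.

Lemma tens_incl_inj (W L : submod M) : Gr L W -> injective (@tens_incl W L).
Proof.
move=> sWL; apply: (can_inj (g := @tens_incl L W)).
apply: (@tens_ext _ _ _ _ (@tens_incl L W \o @tens_incl W L) id) => [x y|x y|w v] //=.
  by rewrite /tens_incl /tmap !(tliftD (tens_incl_bal _ _)).
rewrite /tens_incl /tmap !(tlift_pure (tens_incl_bal _ _)) /=.
by rewrite vsprojK ?vsvalK // (subvP sWL) // subvsP.
Qed.

Definition pairs_Ft (L : submod M) : set {W : submod M & tens2 W} :=
  [set Wi | [/\ Gr L (projT1 Wi), S2t (projT2 Wi) & U_F (projT2 Wi) !=set0]].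

End Moment.

Definition lagrangian (F : fieldType) (M : sntModule F) (W : {vspace M}) :=
  orthov (snt_form M) W = W.

Definition lagrangian_decomposition (F : fieldType) (M : sntModule F)
    (Mm Mp : submod M) :=
  [/\ (Mm + Mp)%VS = fullv, (Mm :&: Mp)%VS = 0%VS, lagrangian Mm & lagrangian Mp].

Arguments orbit_Ft {F M V} b {W} x.
Arguments orbits_Ft {F M V} b W.
Arguments pairs_Ft {F M V} b L.
Arguments f_ {F M V} b {W} x v.
Arguments T_ {F M V} b {W} x.
Arguments U_F {F M V} b {W} i.
Arguments tens_incl {F M V} {W} L x.

(* Main.v *)
From HB Require Import structures.
Require Import Defs.
From mathcomp Require Import all_boot all_algebra all_field.
From mathcomp Require Import sesquilinear.
From mathcomp Require Import boolp classical_sets functions.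
From mathcomp Require Import ring.

(* Write N for the matrix of t on W, S for the Gram matrix of V and X for the   *)
(* coordinate matrix of x in W (x) V. By Nakayama, f_x is onto W iff no nonzero *)
(* functional on W kills both tW and X; since 2 is invertible this is also the  *)
(* condition for T_W to be submersive at x. As x lies in Im f_x (x) V, it       *)
(* remains to see that x and y with f_x, f_y onto W and T_W(x) = T_W(y) are     *)
(* conjugate. This goes by t-adic approximation: when Y = X mod t^k (x) V, the  *)
(* equality T_W(x) = T_W(y) is tested mod t^(k+1) by the functionals on W that  *)
(* kill t^(k+1)W. For k = 0 it allows Witt's extension theorem over F to move   *)
(* X to Y mod t; for k > 0 it yields an infinitesimal isometry Xi of V with     *)
(* Y = X + t^k X Xi mod t^(k+1), which the Cayley transform of t^k Xi / 2       *)
(* integrates to an element of G(F[[t]]). Finitely many steps suffice, as t is  *)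
(* nilpotent on W.                                                              *)

(** The pair attached to x depends only on its orbit: for g in G(F[[t]]) the composite of f_{gx}
    with g is f_x, and T_W(x) = (id (x) f_x)(x) ([f_act], [T_act]). By [tensor_dual_basis], x comes
    from a tensor over W = Im f_x, so all takes place over a fixed W, for the x with f_x onto W
    ([orbit_pair]). Two facts remain.

    Which pairs occur ([pairs_FtP]). Let B be the polarization [momentB] of T_W, so that z -> B(x,
    z) + B(z, x) is a differential of T_W at x. If f_x is onto W, then B(-, x) is onto the tensor
    square of W, and halving yields every symmetric tensor ([surj_submersive]). If f_x is not onto,
    some nonzero functional l kills tW and x; then l (x) l kills the image of every differential,
    but not every w (x) w ([submersive_generating], [surj_generating]).

    T_W separates the orbits ([orbit_of_moment]). Each approximation step is a problem of linear
    algebra over F: [witt_extension] solves the one at order 0 ([lift_start]), and its infinitesimal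
    form [skew_extension] the ones at higher order ([lift_step]). The functionals [pairing] turn the
    equality of tensors into equalities of matrices. *)

Set Implicit Arguments.
Unset Strict Implicit.
Unset Printing Implicit Defensive.

Import GRing.Theory.
Import VectorInternalTheory.
Local Open Scope ring_scope.
Local Open Scope classical_set_scope.

(** * Witt extension over a field *)

Section FormMatrix.
Variables (F : fieldType) (n : nat) (S : 'M[F]_n).
Hypothesis S_sym : S^T = S.
Hypothesis S_unit : S \in unitmx.
Hypothesis two_neq0 : 2%:R != 0 :> F.

Implicit Types u v w z : 'rV[F]_n.

Definition mxform u v : F := (u *m S *m v^T) 0 0.
Local Notation "[< u , v >]" := (mxform u v) (at level 0).

Lemma mxformDl u1 u2 v : [< u1 + u2, v >] = [< u1, v >] + [< u2, v >].
Proof. by rewrite /mxform !mulmxDl mxE. Qed.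

Lemma mxformZl a u v : [< a *: u, v >] = a * [< u, v >].
Proof. by rewrite /mxform -!scalemxAl mxE. Qed.

Lemma mxformC u v : [< u, v >] = [< v, u >].
Proof.
transitivity ((u *m S *m v^T)^T 0 0); first by rewrite [RHS]mxE.
by rewrite !trmx_mul trmxK S_sym mulmxA.
Qed.

Lemma mxformDr u v1 v2 : [< u, v1 + v2 >] = [< u, v1 >] + [< u, v2 >].
Proof. by rewrite mxformC mxformDl !(mxformC u). Qed.

Lemma mxformZr a u v : [< u, a *: v >] = a * [< u, v >].
Proof. by rewrite mxformC mxformZl mxformC. Qed.

Lemma mxformNl u v : [< - u, v >] = - [< u, v >].
Proof. by rewrite -scaleN1r mxformZl mulN1r. Qed.

Lemma mxformNr u v : [< u, - v >] = - [< u, v >].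
Proof. by rewrite mxformC mxformNl mxformC. Qed.

Definition mxformE := (mxformDl, mxformDr, mxformZl, mxformZr, mxformNl, mxformNr).

Lemma mxform_row p (H : 'M_(p, n)) u i : [< row i H, u >] = (H *m S *m u^T) i 0.
Proof. by rewrite /mxform -!row_mul mxE. Qed.

Definition isometry_mx (g : 'M[F]_n) := g *m S *m g^T = S.

Lemma isometry_mxP (g : 'M[F]_n) :
  (forall u v, [< u *m g, v *m g >] = [< u, v >]) -> isometry_mx g.
Proof.
move=> h; apply/matrixP => i j; have := h (delta_mx 0 i) (delta_mx 0 j).
rewrite -!rowE mxform_row tr_row colE mulmxA -colE mxE => ->.
by rewrite /mxform -rowE trmx_delta -colE !mxE.
Qed.

Lemma isometry_mx_unit g : isometry_mx g -> g \in unitmx.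
Proof.
move=> /(congr1 determinant); rewrite !det_mulmx det_tr => h.
move: S_unit; rewrite !unitmxE -h !unitfE => h0; apply/eqP => g0.
by move: h0; rewrite g0 mulr0 eqxx.
Qed.

Lemma isometry_mxK g p q (A : 'M_(p, n)) (B : 'M_(q, n)) : isometry_mx g ->
  (A *m g) *m S *m (B *m g)^T = A *m S *m B^T.
Proof. by move=> iso; rewrite -[in RHS]iso trmx_mul !mulmxA. Qed.

Lemma isometry_mx1 : isometry_mx 1%:M.
Proof. by rewrite /isometry_mx mul1mx trmx1 mulmx1. Qed.

Lemma isometry_mxM g h : isometry_mx g -> isometry_mx h -> isometry_mx (g *m h).
Proof.
rewrite /isometry_mx => hg hh.
by rewrite isometry_mxK.
Qed.

Definition rank1_mx z w : 'M[F]_n := S *m z^T *m w.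

Lemma mul_rank1_mx v z w : v *m rank1_mx z w = [< v, z >] *: w.
Proof.
by rewrite /rank1_mx !mulmxA [v *m S *m z^T]mx11_scalar mul_scalar_mx.
Qed.

Lemma mul_rank1_mx0 p (H : 'M_(p, n)) z w :
  H *m S *m z^T = 0 -> H *m rank1_mx z w = 0.
Proof. by rewrite /rank1_mx !mulmxA => ->; rewrite mul0mx. Qed.

Lemma isometry_reflection w : [< w, w >] != 0 ->
  isometry_mx (1%:M - (2%:R / [< w, w >]) *: rank1_mx w w).
Proof.
move=> w0; apply: isometry_mxP => u v.
rewrite !mulmxBr !mulmx1 -!scalemxAr !mul_rank1_mx !mxformE (mxformC w v).
by field.
Qed.

(** The Eichler transformation of an isotropic w and of z orthogonal to w: it sends any u orthogonal
    to w to u + [u, z] w. *)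
Lemma isometry_eichler z w : [< w, w >] = 0 -> [< w, z >] = 0 ->
  isometry_mx (1%:M + rank1_mx z w - rank1_mx w z
               - (2%:R^-1 * [< z, z >]) *: rank1_mx w w).
Proof.
move=> ww wz; apply: isometry_mxP => u v.
rewrite !mulmxBr !mulmxDr !mulmx1 -!scalemxAr !mul_rank1_mx !mxformE.
rewrite (mxformC w v) (mxformC z v) (mxformC z w) ww wz.
by field.
Qed.

(** Scales w by s and z by s^-1 in the hyperbolic plane they span, and fixes the orthogonal of that
    plane. *)
Lemma isometry_hyperbolic z w s : s != 0 ->
  [< w, w >] = 0 -> [< z, z >] = 0 -> [< w, z >] = 1 ->
  isometry_mx (1%:M + (s - 1) *: rank1_mx z w + (s^-1 - 1) *: rank1_mx w z).
Proof.
move=> s0 ww zz wz; apply: isometry_mxP => u v.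
rewrite !mulmxDr !mulmx1 -!scalemxAr !mul_rank1_mx !mxformE.
rewrite (mxformC w v) (mxformC z v) (mxformC z w) ww wz zz.
by field.
Qed.

Lemma separating_vector p (H : 'M_(p, n)) u : ~~ (u <= H)%MS ->
  exists2 z, H *m S *m z^T = 0 & [< u, z >] = 1.
Proof.
rewrite submxE => /rV0Pn[j nz].
pose a := (u *m cokermx H) 0 j.
pose z := a^-1 *: (invmx S *m col j (cokermx H))^T.
have zE : S *m z^T = a^-1 *: col j (cokermx H).
  by rewrite /z linearZ /= trmxK -scalemxAr mulKVmx.
exists z; first by rewrite -mulmxA zE -scalemxAr colE mulmxA mulmx_coker mul0mx scaler0.
rewrite /mxform -mulmxA zE -scalemxAr colE mulmxA -colE mxE [X in _ * X]mxE.
by rewrite mulVf.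
Qed.

(** The inductive step of Witt's theorem. The difference w = u - u' is orthogonal to H; if it is
    anisotropic, the reflection in w exchanges u and u', since [w, w] = 2 [u, w]. *)
Lemma witt_extend1 p (H : 'M_(p, n)) u u' :
  ~~ (u <= H)%MS -> ~~ (u' <= H)%MS ->
  H *m S *m u^T = H *m S *m u'^T -> [< u, u >] = [< u', u' >] ->
  exists g, [/\ isometry_mx g, H *m g = H & u *m g = u'].
Proof.
move=> uH u'H eqH equ; move wE: (u - u') => w.
have Hw : H *m S *m w^T = 0 by rewrite -wE linearB /= mulmxBr eqH subrr.
have ww : [< w, w >] = 2%:R * [< u, w >].
  by rewrite -wE !mxformE (mxformC u' u) -equ; ring.
have u'E : u' = u - w by rewrite -wE opprB addrC subrK.
have [ww0|ww0] := eqVneq [< w, w >] 0; last first.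
  exists (1%:M - (2%:R / [< w, w >]) *: rank1_mx w w); split.
  - exact: isometry_reflection.
  - by rewrite mulmxBr mulmx1 -scalemxAr mul_rank1_mx0 // scaler0 subr0.
  - rewrite mulmxBr mulmx1 -scalemxAr mul_rank1_mx scalerA mulrAC -ww divff //.
    by rewrite scale1r.
have uw : [< u, w >] = 0.
  by move/eqP: ww; rewrite ww0 eq_sym mulf_eq0 (negbTE two_neq0) => /eqP.
(* Now w is isotropic and orthogonal to u. An Eichler transformation sends u to u - w once some z
   orthogonal to w and H has [u, z] = -1; such a z exists unless u lies in the span of w and H. *)
have [ucH|ucH] := boolP (u <= col_mx w H)%MS; last first.
  have [z0 zc zu] := separating_vector ucH.
  pose z := - z0.
  have [zw zH] : w *m S *m z^T = 0 /\ H *m S *m z^T = 0.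
    rewrite /z linearN /= !mulmxN; move: zc; rewrite !mul_col_mx.
    by rewrite -[0]vsubmxK => /eq_col_mx[-> ->]; rewrite !linear0 ?oppr0.
  have wz : [< w, z >] = 0 by rewrite /mxform zw mxE.
  eexists; split; first exact: (isometry_eichler ww0 wz).
  - rewrite !mulmxBr !mulmxDr mulmx1 -!scalemxAr !mul_rank1_mx0 //.
    by rewrite scaler0 !subr0 addr0.
  - rewrite !mulmxBr !mulmxDr mulmx1 -!scalemxAr !mul_rank1_mx uw !scale0r.
    by rewrite scaler0 !subr0 /z mxformNr zu scaleN1r u'E.
(* Here u = c w + h H and u' = (c - 1) w + h H. Neither lies in the row space of H, so c and c - 1
   are nonzero, and scaling w by (c - 1) / c moves u to u'. *)
have [y] := submxP ucH; rewrite -[y]hsubmxK mul_row_col [lsubmx y]mx11_scalar.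
rewrite mul_scalar_mx; set c := lsubmx y 0 0; set h := rsubmx y => uE.
have c0 : c != 0.
  by apply: contraNneq uH => c0; rewrite uE c0 scale0r add0r submxMl.
have c1 : c - 1 != 0.
  apply: contraNneq u'H => /subr0_eq c1.
  by rewrite u'E {1}uE c1 scale1r addrAC subrr add0r submxMl.
have wH : ~~ (w <= H)%MS.
  by apply: contra uH => wH; rewrite uE addmx_sub ?scalemx_sub ?submxMl.
have [z0 zH wz0] := separating_vector wH.
pose z := z0 - (2%:R^-1 * [< z0, z0 >]) *: w.
have zz : [< z, z >] = 0.
  by rewrite /z !mxformE (mxformC z0 w) wz0 ww0; field.
have wz : [< w, z >] = 1 by rewrite /z !mxformE ww0 wz0 !mulr0 subr0.
have Hz : H *m S *m z^T = 0.
  by rewrite /z linearB linearZ /= mulmxBr -scalemxAr zH Hw scaler0 subr0.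
pose s := (c - 1) / c.
have s0 : s != 0 by rewrite mulf_neq0 ?invr_eq0.
have HE : H *m (1%:M + (s - 1) *: rank1_mx z w + (s^-1 - 1) *: rank1_mx w z) = H.
  by rewrite !mulmxDr mulmx1 -!scalemxAr !mul_rank1_mx0 // !scaler0 !addr0.
eexists; split; first exact: (isometry_hyperbolic s0 ww0 zz wz).
  exact: HE.
rewrite {1}uE mulmxDl -mulmxA HE -scalemxAl !mulmxDr mulmx1 -!scalemxAr.
rewrite !mul_rank1_mx ww0 wz scale0r scaler0 addr0 scale1r -{1}[w]scale1r.
rewrite -scalerDl scalerA u'E uE addrAC; congr (_ + _).
rewrite -{3}[w]scale1r -scalerBl; congr (_ *: _).
by rewrite /s; field.
Qed.

Lemma row_free_col_mx p u (H : 'M_(p, n)) : row_free (col_mx u H) ->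
  row_free H /\ ~~ (u <= H)%MS.
Proof.
move=> uH; split.
  apply/inj_row_free => v vH; apply/eqP.
  have := mulmx_free_eq0 (row_mx 0 v : 'rV_(1 + p)) uH.
  rewrite mul_row_col !mul0mx vH addr0 eqxx => /esym/eqP.
  by rewrite -[0 in RHS]row_mx0 => /eq_row_mx[_ ->].
apply/negP => /submxP[y uE].
have := mulmx_free_eq0 (row_mx 1%:M (- y) : 'rV_(1 + p)) uH.
rewrite mul_row_col mul1mx mulNmx -uE subrr eqxx => /esym/eqP.
rewrite -[0 in RHS]row_mx0 => /eq_row_mx[/matrixP/(_ 0 0)/eqP].
by rewrite !mxE /= oner_eq0.
Qed.

Theorem witt_extension p (A B : 'M[F]_(p, n)) : row_free A -> row_free B ->
  A *m S *m A^T = B *m S *m B^T -> exists2 g, isometry_mx g & A *m g = B.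
Proof.
elim: p A B => [|p IH].
  move=> A B _ _ _.
  by exists 1%:M; [exact: isometry_mx1 | rewrite [A]flatmx0 [B]flatmx0 mul0mx].
rewrite -[p.+1]/(1 + p)%N => A B; rewrite -[A]vsubmxK -[B]vsubmxK.
move: (usubmx A) (dsubmx A) (usubmx B) (dsubmx B) => u H u' H' {A B} freeA freeB.
rewrite !mul_col_mx !tr_col_mx !mul_mx_row.
move=> /eq_col_mx[/eq_row_mx[uu _] /eq_row_mx[Hu HH]].
have [freeH uH] := row_free_col_mx freeA.
have [freeH' uH'] := row_free_col_mx freeB.
have [g1 iso1 Hg1] := IH _ _ freeH freeH' HH.
have u1H' : ~~ (u *m g1 <= H')%MS.
  apply: contra uH; rewrite -Hg1 => /(submxMr (invmx g1)).
  by rewrite !mulmxK // isometry_mx_unit.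
have Hu1 : H' *m S *m (u *m g1)^T = H' *m S *m u'^T.
  by rewrite -Hu -Hg1 isometry_mxK.
have uu1 : [< u *m g1, u *m g1 >] = [< u', u' >].
  by rewrite /mxform isometry_mxK // uu.
have [g2 [iso2 Hg2 ug2]] := witt_extend1 u1H' uH' Hu1 uu1.
exists (g1 *m g2); first exact: isometry_mxM.
by rewrite mul_col_mx !mulmxA ug2 Hg1 Hg2.
Qed.

(** The infinitesimal form of [witt_extension]: a first-order variation E of the free family D that
    preserves its Gram matrix is induced by an element of the Lie algebra of the orthogonal
    group. *)
Lemma skew_extension p (D E : 'M[F]_(p, n)) : row_free D ->
  D *m S *m E^T + E *m S *m D^T = 0 ->
  exists2 X : 'M[F]_n, X *m S + S *m X^T = 0 & D *m X = E.
Proof.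
move=> freeD skewDE.
have [Q DQ] : exists Q, D *m Q = 1%:M by exists (pinvmx D); exact: mulmxVp.
have ESD : E *m S *m D^T = - (D *m S *m E^T).
  by apply/eqP; rewrite -addr_eq0 addrC skewDE.
(* [G] is the skew form extending [(E _, _)] from the row space of [D], where  *)
(* [Q *m D] projects.                                                           *)
pose M := Q *m E *m S; pose K := Q *m (E *m S *m D^T) *m Q^T.
have KT : K^T = - K.
  by rewrite /K !trmx_mul !trmxK S_sym ESD !(mulmxN, mulNmx) opprK !mulmxA.
(* K is set so that D K = - D M^T; the last two terms then cancel on the rows of D, and D G = D M =
   E S. *)
pose G := M - M^T - K.
have GT : G^T = - G.
  rewrite /G [LHS]linearB /= [in LHS]linearB /= trmxK KT !opprD !opprK.
  by rewrite [M^T - M]addrC.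
exists (G *m invmx S).
  by rewrite trmx_mul trmx_inv S_sym GT mulmxKV // mulmxA mulmxV // mul1mx subrr.
have DM : D *m M = E *m S by rewrite /M !mulmxA DQ mul1mx.
have DMT : D *m M^T = D *m S *m E^T *m Q^T by rewrite /M !trmx_mul S_sym !mulmxA.
have DK : D *m K = - (D *m M^T).
  by rewrite /K !mulmxA DQ mul1mx ESD mulNmx DMT.
by rewrite mulmxA /G !mulmxBr DK opprK subrK DM mulmxK.
Qed.

End FormMatrix.

(** * One step of the t-adic approximation *)

Section Step.
Variables (F : fieldType) (m n : nat) (S : 'M[F]_n) (N : 'M[F]_m).
Hypothesis S_sym : S^T = S.
Hypothesis S_unit : S \in unitmx.
Hypothesis two_neq0 : 2%:R != 0 :> F.

Implicit Types (X Y : 'M[F]_(m, n)) (l : 'rV[F]_m).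

(** Rows are functionals on W. This is the dual form of the statement that the columns of X span W
    modulo tW. *)
Definition generating X := forall l, l *m N = 0 -> l *m X = 0 -> l = 0.

(** For l killing t^(k+1) W, the map w -> sum_i l(t^i w) t^(k-i) is F[[t]]-linear from W to
    F[t]/t^(k+1). The coefficient of t^k in the product of two such maps is a functional on the
    tensor square over F[[t]]; [twist_mx] is its matrix form. *)
Definition twist_mx k (A : 'M[F]_m) : 'M[F]_m :=
  \sum_(i < k.+1) N ^+ i *m A *m (N ^+ (k - i))^T.

Lemma twist_mx_linear k : linear (twist_mx k).
Proof.
move=> a A B; rewrite /twist_mx scaler_sumr -big_split /=; apply: eq_bigr => i _.
by rewrite mulmxDr mulmxDl -scalemxAr -scalemxAl.
Qed.

HB.instance Definition _ k :=
  GRing.isLinear.Build F 'M[F]_m 'M[F]_m _ (twist_mx k) (twist_mx_linear k).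

(** Moving t across the tensor sign shifts the summation index by one, and each of the two boundary
    terms contains N^(k+1) next to l or l'. *)
Lemma twist_mx_shift1 k (l l' : 'rV_m) A :
  l *m N ^+ k.+1 = 0 -> l' *m N ^+ k.+1 = 0 ->
  l *m twist_mx k (N *m A) *m l'^T = l *m twist_mx k (A *m N^T) *m l'^T.
Proof.
move=> lN l'N; rewrite /twist_mx [in LHS]big_ord_recr [in RHS]big_ord_recl /=.
have NE : N *m N ^+ k = N ^+ k.+1 by rewrite exprS.
have EN : N ^+ k *m N = N ^+ k.+1 by rewrite exprSr.
rewrite [in LHS]mulmxDr [in RHS]mulmxDr.
rewrite [X in (_ + X) *m _](_ : _ = 0); last first.
  by rewrite [N ^+ k *m (N *m A)]mulmxA EN !mulmxA lN !mul0mx.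
rewrite addr0 [RHS]mulmxDl [X in _ = X + _](_ : _ = 0) ?add0r; last first.
  rewrite expr0 mul1mx subn0 -!mulmxA -!trmx_mul.
  by rewrite -mulmxA EN l'N trmx0 !mulmx0.
congr (_ *m _ *m _); apply: eq_bigr => i _.
rewrite /bump add1n mulmxA -[N ^+ i *m N]/(N ^+ i * N) -exprSr.
by rewrite -(subnSK (ltn_ord i)) [N ^+ (_ - _).+1]exprSr -mulmxE trmx_mul -!mulmxA.
Qed.

Lemma twist_mx_shift k j (l l' : 'rV_m) A :
  l *m N ^+ k.+1 = 0 -> l' *m N ^+ k.+1 = 0 ->
  l *m twist_mx k (N ^+ j *m A) *m l'^T =
  l *m twist_mx k (A *m (N ^+ j)^T) *m l'^T.
Proof.
move=> lN l'N; elim: j A => [|j IH] A; first by rewrite expr0 trmx1 mul1mx mulmx1.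
rewrite [in LHS]exprS [in RHS]exprSr -!mulmxE -[N *m _ *m A]mulmxA.
by rewrite twist_mx_shift1 // -[_ *m A *m _]mulmxA IH trmx_mul !mulmxA.
Qed.

Definition moment_mx k X : 'M[F]_m := twist_mx k (X *m S *m X^T).

Definition same_moment X Y := forall k l l',
  l *m N ^+ k.+1 = 0 -> l' *m N ^+ k.+1 = 0 ->
  (l *m moment_mx k X *m l'^T) 0 0 = (l *m moment_mx k Y *m l'^T) 0 0.

Lemma mulmx_kermx_factor p q (A : 'M[F]_(m, p)) (B : 'M[F]_(m, q)) :
  (forall l, l *m A = 0 -> l *m B = 0) -> exists Q, B = A *m Q.
Proof.
move=> kerAB; exists (pinvmx A *m B); rewrite mulmxA; apply/eqP.
rewrite -subr_eq0 -{1}[B]mul1mx -mulmxBl; apply/eqP/row_matrixP => i.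
rewrite row_mul row0 kerAB // -row_mul mulmxBl mul1mx mulmxKpV ?subrr //.
by rewrite row0.
Qed.

Lemma same_moment_mx X Y k p (L : 'M_(p, m)) : same_moment X Y ->
  L *m N ^+ k.+1 = 0 -> L *m moment_mx k X *m L^T = L *m moment_mx k Y *m L^T.
Proof.
have E (A : 'M[F]_m) i j :
    (L *m A *m L^T) i j = (row i L *m A *m (row j L)^T) 0 0.
  by rewrite -!row_mul tr_row colE mulmxA -colE !mxE.
move=> sXY LN; apply/matrixP => i j; rewrite !E.
by apply: sXY; rewrite -row_mul LN row0.
Qed.

(* The rows of [L *m N ^+ k] form a basis of [ker N :&: im (N ^+ k)], acting on *)
(* row vectors.                                                                 *)
Lemma kernel_frame k : exists p (L : 'M[F]_(p, m)),
  [/\ L *m N ^+ k.+1 = 0, row_free (L *m N ^+ k)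
    & forall l, l *m N ^+ k.+1 = 0 -> (l *m N ^+ k <= L *m N ^+ k)%MS].
Proof.
pose K := kermx (N ^+ k.+1); pose P := row_base (K *m N ^+ k).
have [C PE] : exists C, P = C *m (K *m N ^+ k).
  by apply/submxP; rewrite eq_row_base.
exists _, (C *m K); rewrite -!mulmxA -PE; split; first by rewrite mulmx_ker mulmx0.
  exact: row_base_free.
by move=> l /sub_kermxP lK; rewrite eq_row_base submxMr.
Qed.

Section Frame.
Variables (k p : nat) (L : 'M[F]_(p, m)).
Hypothesis LN : L *m N ^+ k.+1 = 0.
Hypothesis freeL : row_free (L *m N ^+ k).
Hypothesis maxL : forall l, l *m N ^+ k.+1 = 0 -> (l *m N ^+ k <= L *m N ^+ k)%MS.

(** A relation c among these rows gives the functional c L N^k, which kills both tW and X. *)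
Lemma frame_free X : generating X -> row_free (L *m N ^+ k *m X).
Proof.
move=> genX; apply/inj_row_free => c; rewrite mulmxA => cX.
apply/eqP; rewrite -(mulmx_free_eq0 c freeL); apply/eqP/genX => //.
by rewrite -!mulmxA mulmxE -exprSr LN mulmx0.
Qed.

(** Divisibility by N^(k+1) is tested by the functionals killing its image, and the frame L accounts
    for all of them. *)
Lemma frame_divides q (A : 'M_(m, q)) : L *m N ^+ k *m A = 0 ->
  exists Q, N ^+ k *m A = N ^+ k.+1 *m Q.
Proof.
move=> LA; apply: mulmx_kermx_factor => l /maxL /submxP[c lE].
by rewrite mulmxA lE -!mulmxA (mulmxA L) LA mulmx0.
Qed.

End Frame.

Lemma lift_start X Y : generating X -> generating Y -> same_moment X Y ->
  exists2 g, isometry_mx S g & exists Q, Y = X *m g + N *m Q.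
Proof.
move=> genX genY sXY; have [p [L [LN freeL maxL]]] := kernel_frame 0.
have [g iso gE] : exists2 g, isometry_mx S g & L *m N ^+ 0 *m X *m g = L *m N ^+ 0 *m Y.
  apply: witt_extension => //; [exact: frame_free | exact: frame_free |].
  have := same_moment_mx sXY LN; rewrite /moment_mx /twist_mx !big_ord_recl !big_ord0 /=.
  rewrite !expr0 !addr0 !trmx1 !mul1mx !mulmx1 !trmx_mul.
  by rewrite !mulmxA.
exists g => //; have [|Q] := frame_divides maxL (A := Y - X *m g).
  by rewrite mulmxBr mulmxA gE subrr.
rewrite expr0 expr1 mul1mx => QE; exists Q.
by rewrite -QE addrC subrK.
Qed.

(** It suffices that X Xi and Z agree on the frame, by [frame_divides]. There, equality of moments
    at order k says that Z is a first-order variation of X preserving the Gram matrix. *)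
Lemma lift_step k X Y Z : (0 < k)%N -> generating X -> same_moment X Y ->
  Y = X + N ^+ k *m Z ->
  exists2 Xi : 'M[F]_n, Xi *m S + S *m Xi^T = 0 &
    exists Q, Y = X + N ^+ k *m X *m Xi + N ^+ k.+1 *m Q.
Proof.
move=> k0 genX sXY YE; have [p [L [LN freeL maxL]]] := kernel_frame k.
have LN0 i : (0 < i)%N -> L *m (N ^+ i *m N ^+ k) = 0.
  case: i => // i _; rewrite mulmxE -exprD addSnnS addnC exprD -mulmxE mulmxA.
  by rewrite LN mul0mx.
have NL0 i : (0 < i)%N -> (N ^+ k)^T *m (N ^+ i)^T *m L^T = 0.
  move=> i0; rewrite -!trmx_mul -[RHS]trmx0; congr _^T.
  by rewrite -(LN0 _ i0).
have [Xi skewXi XiE] : exists2 Xi : 'M[F]_n, Xi *m S + S *m Xi^T = 0 &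
    L *m N ^+ k *m X *m Xi = L *m N ^+ k *m Z.
  apply: skew_extension => //; first exact: frame_free.
  have := same_moment_mx sXY LN; move/eqP; rewrite eq_sym -subr_eq0.
  rewrite -mulmxBl -mulmxBr /moment_mx /twist_mx -sumrB mulmx_sumr mulmx_suml.
  (* The parts of the difference of moments with Z on the right, on the left, and on both sides.
     Since L N^(k+1) = 0, only i = k survives in [T1], only i = 0 in [T2], and nothing in [T3]
     because k > 0. What is left is the hypothesis of [skew_extension] for D = L N^k X and E = L N^k
     Z. *)
  pose T1 i := L *m N ^+ i *m X *m S *m Z^T *m ((N ^+ k)^T *m (N ^+ (k - i))^T *m L^T).
  pose T2 i := L *m (N ^+ i *m N ^+ k) *m Z *m S *m X^T *m (N ^+ (k - i))^T *m L^T.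
  pose T3 i := L *m (N ^+ i *m N ^+ k) *m Z *m S *m Z^T *m
     ((N ^+ k)^T *m (N ^+ (k - i))^T *m L^T).
  rewrite (eq_bigr (fun i : 'I_k.+1 => T1 i + T2 i + T3 i)); last first.
    move=> i _; rewrite -mulmxBl -mulmxBr.
    have -> : Y *m S *m Y^T - X *m S *m X^T = X *m S *m Z^T *m (N ^+ k)^T
        + N ^+ k *m Z *m S *m X^T + N ^+ k *m Z *m S *m Z^T *m (N ^+ k)^T.
      rewrite YE [(X + _)^T]linearD /= trmx_mul !(mulmxDl, mulmxDr) !mulmxA.
      rewrite -!addrA [LHS]addrC !addrA subrK; congr (_ + _); exact: addrC.
    by rewrite /T1 /T2 /T3 !(mulmxDl, mulmxDr) !mulmxA.
  rewrite !big_split /= [X in _ + X]big1 ?addr0 => [|i _]; last first.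
    have [i0|i0] := posnP i; last by rewrite /T3 LN0 // !mul0mx.
    by rewrite /T3 NL0 ?mulmx0 // i0 subn0.
  rewrite (bigD1 ord_max) //= big1 => [|i]; last first.
    rewrite -val_eqE /= => ik; rewrite /T1 NL0 ?mulmx0 //.
    by rewrite subn_gt0 ltn_neqAle ik -ltnS /=.
  rewrite (bigD1 ord0) //= big1 => [|i]; last first.
    by rewrite -val_eqE -lt0n => i0; rewrite /T2 LN0 // !mul0mx.
  rewrite /T1 /T2 subnn subn0 expr0 trmx1 mulmx1 mul1mx !addr0 !trmx_mul.
  by rewrite !mulmxA => /eqP.
exists Xi => //; have [|Q QE] := frame_divides maxL (A := Z - X *m Xi).
  by rewrite mulmxBr mulmxA XiE subrr.
by exists Q; rewrite -QE YE mulmxBr -addrA mulmxA; congr (_ + _); rewrite addrC subrK.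
Qed.

End Step.

(** * Coordinates *)

Section LinearMaps.
Variables (F : fieldType) (U U' : vectType F).

Definition op_mx (f : {linear U -> U'}) : 'M[F]_(dim U, dim U') :=
  lin1_mx (v2r \o f \o r2v).

Lemma v2r_op_mx (f : {linear U -> U'}) u : v2r (f u) = v2r u *m op_mx f.
Proof. by rewrite mul_rV_lin1 /= v2rK. Qed.

End LinearMaps.

Lemma linear_inverse (R : pzRingType) (U U' : lmodType R) (h : {linear U -> U'}) :
  bijective h -> exists2 h' : {linear U' -> U}, cancel h h' & cancel h' h.
Proof.
case=> h' hK h'K.
have h'lin : linear h' by apply: (can2_linear hK h'K).
pose mixin := GRing.isLinear.Build _ _ _ _ h' h'lin.
by exists (HB.pack h' mixin : {linear U' -> U}).
Qed.

Section Forms.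
Variables (F : fieldType) (V : vectType F) (b : {symmetric V}).

Definition gram : 'M[F]_(dim V) :=
  \matrix_(i, j) b (r2v (delta_mx 0 i)) (r2v (delta_mx 0 j)).

Lemma vec_sum_delta (u : V) : u = \sum_i (v2r u) 0 i *: r2v (delta_mx 0 i).
Proof.
rewrite -[LHS]v2rK [in LHS](row_sum_delta (v2r u)) linear_sum.
by apply: eq_bigr => i _; rewrite linearZ.
Qed.

Lemma gramE u v : b u v = (v2r u *m gram *m (v2r v)^T) 0 0.
Proof.
rewrite [in LHS](vec_sum_delta u) [in LHS](vec_sum_delta v) linear_sumr /= mxE.
apply: eq_bigr => j _; rewrite linearZr_LR linear_sumlz /= !mxE mulrC.
congr (_ * _); apply: eq_bigr => i _; rewrite linearZl_LR /= mxE //.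
Qed.


Lemma gram_sym : gram^T = gram.
Proof. by apply/matrixP => i j; rewrite !mxE symmC. Qed.

Lemma gram_unit : nondegenerate b -> gram \in unitmx.
Proof.
move=> /eqP hb; rewrite -row_free_unit; apply/inj_row_free => v vG.
suff: r2v v \in orthov b fullv.
  by rewrite hb memv0 => /eqP/(congr1 v2r); rewrite r2vK linear0.
apply/mem_orthovP => u _; rewrite gramE r2vK vG mul0mx mxE //.
Qed.


End Forms.

Section Series.
Variables (F : fieldType) (V : vectType F).

Lemma psX_scale k (v : vseries V) j :
  (psX F k *: v) j = if (k <= j)%N then v (j - k)%N else 0.
Proof.
rewrite [LHS]/(vsZ _ _ _) /psX; case: leqP => [le_kj|lt_jk].
  rewrite (bigD1 (Ordinal (le_kj : k < j.+1)%N)) //= eqxx scale1r big1 ?addr0 //.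
  by move=> i; rewrite -val_eqE /= => /negbTE ->; rewrite scale0r.
by rewrite big1 // => i _; rewrite ltn_eqF ?scale0r // (leq_trans (ltn_ord i)).
Qed.

Lemma vseriesDE (v w : vseries V) j : (v + w) j = v j + w j.
Proof. by []. Qed.

Definition vsmap (a : {linear V -> V}) (v : vseries V) : vseries V := fun j => a (v j).

Lemma vsmap_linear a : linear (vsmap a).
Proof.
move=> p v w; apply/funext => j; rewrite [RHS]vseriesDE /vsmap vseriesDE linearD.
congr (_ + _); rewrite [(p *: v) j]/(vsZ _ _ _) linear_sum.
by apply: eq_bigr => i _; rewrite linearZ.
Qed.

HB.instance Definition _ a :=
  GRing.isLinear.Build (pseries F) (vseries V) (vseries V) _ (vsmap a) (vsmap_linear a).

End Series.

(** * The moment map *)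

Section Moments.
Variables (F : fieldType) (M : ntModule F) (V : vectType F) (b : {symmetric V}).
Variable W : submod M.

Local Notation tF := (tensF V W).
Local Notation tFt := (tensFt V W).
Implicit Types (x y z : tF) (g h : {linear vseries V -> vseries V}).

Lemma to_FtD : {morph @to_Ft F M V W : x y / x + y}.
Proof. exact: (tliftD (@to_Ft_bal F M V W)). Qed.

Lemma of_FtD : {morph @of_Ft F M V W : x y / x + y}.
Proof. exact: (tliftD (@of_Ft_bal F M V W)). Qed.

Lemma to_Ft_pure (u : subvs_of W) (v : V) :
  to_Ft (tpure u v : tF) = tpure (u : submod_Ft W) (vsC v : vseries V).
Proof. exact: (tlift_pure (@to_Ft_bal F M V W)). Qed.

Lemma of_Ft_pure (u : submod_Ft W) (w : vseries V) :
  of_Ft (tpure u w) =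
  \sum_(k < nt_idx M) tpure (psX F k *: u : subvs_of W) (w k).
Proof. exact: (tlift_pure (@of_Ft_bal F M V W)). Qed.

Lemma tmap_act_bal g : balanced (fun (u : submod_Ft W) (w : vseries V) =>
  tpure (id u) (g w)).
Proof.
split=> [u u' w|u w w'|p u w]; first exact: tpureDl.
  by rewrite linearD tpureDr.
by rewrite linearZ tpure_bal.
Qed.

Lemma act_FtD g : {morph @act_Ft F M V W g : x y / x + y}.
Proof.
by move=> x y; rewrite /act_Ft to_FtD /tmap (tliftD (tmap_act_bal g)) of_FtD.
Qed.

Lemma act_Ft_pure g (u : subvs_of W) (v : V) :
  act_Ft g (tpure u v : tF) =
  \sum_(k < nt_idx M)
     tpure (psX F k *: (u : submod_Ft W) : subvs_of W) (g (vsC v) k).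
Proof.
by rewrite /act_Ft to_Ft_pure /tmap (tlift_pure (tmap_act_bal g)) of_Ft_pure.
Qed.

Lemma to_Ft_act g x : to_Ft (act_Ft g x) = tmap id g (to_Ft x).
Proof. by rewrite /act_Ft of_FtK. Qed.

Lemma act_Ft_comp g h x : act_Ft (g \o h) x = act_Ft g (act_Ft h x).
Proof.
rewrite [LHS]/act_Ft [RHS]/act_Ft to_Ft_act; congr of_Ft.
move: (to_Ft x); apply: tens_ext => [y z|y z|u w].
- exact: (tliftD (tmap_act_bal (g \o h))).
- by rewrite /tmap (tliftD (tmap_act_bal h)) (tliftD (tmap_act_bal g)).
rewrite /tmap (tlift_pure (tmap_act_bal (g \o h))) (tlift_pure (tmap_act_bal h)).
by rewrite (tlift_pure (tmap_act_bal g)).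
Qed.

Lemma eq_act_Ft g h : g =1 h -> @act_Ft F M V W g =1 act_Ft h.
Proof.
move=> gh x; rewrite /act_Ft; congr of_Ft; congr (tmap _ _ _).
exact/funext.
Qed.

Lemma act_Ft_id x : act_Ft (idfun : vseries V -> vseries V) x = x.
Proof.
rewrite /act_Ft -[RHS]to_FtK; congr of_Ft.
move: (to_Ft x); apply: tens_ext => [y z|y z|u w] //.
- exact: (tliftD (tmap_act_bal idfun)).
- exact: (tlift_pure (tmap_act_bal idfun)).
Qed.

Lemma f_FtD (w : vseries V) : {morph (fun X : tFt => f_Ft b X w) : x y / x + y}.
Proof. exact: (tliftD (@f_Ft_bal F M V b W w)). Qed.

Lemma f_Ft_pure (u : submod_Ft W) (v w : vseries V) :
  f_Ft b (tpure u v) w = vform b v w *: u.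
Proof. exact: (tlift_pure (@f_Ft_bal F M V b W w)). Qed.

Lemma f_Dl x y w : f_ b (x + y) w = f_ b x w + f_ b y w.
Proof. by rewrite /f_ to_FtD f_FtD. Qed.

Lemma f_pure (u : subvs_of W) (v : V) w :
  f_ b (tpure u v : tF) w = vform b (vsC v) w *: (u : submod_Ft W).
Proof. by rewrite /f_ to_Ft_pure f_Ft_pure. Qed.

Lemma f_linear x : linear (f_ b x).
Proof.
move=> p v w; rewrite /f_; move: (to_Ft x) => X {x}.
apply: (@tens_ext _ _ _ _ (fun X => f_Ft b X (p *: v + w))
   (fun X => p *: f_Ft b X v + f_Ft b X w)) => {X} [X Y|X Y|u w'].
- exact: f_FtD.
- by rewrite !f_FtD scalerDr addrACA.
- by rewrite !f_Ft_pure vformDr vformZr scalerDl scalerA.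
Qed.

HB.instance Definition _ x :=
  GRing.isLinear.Build (pseries F) (vseries V) (submod_Ft W) _ (f_ b x) (f_linear x).

(** The isometry g cancels between the two arguments of the form. As g is bijective, f_x and f_{gx}
    have the same image. *)
Lemma f_act g x w : orthogonal_Ft b g -> f_ b (act_Ft g x) (g w) = f_ b x w.
Proof.
case=> _ iso; rewrite /f_ to_Ft_act; move: (to_Ft x) => X {x}.
apply: (@tens_ext _ _ _ _ (fun X => f_Ft b (tmap id g X) (g w))
   (fun X => f_Ft b X w)) => {X} [X Y|X Y|u v].
- by rewrite /tmap (tliftD (tmap_act_bal g)) f_FtD.
- exact: f_FtD.
- by rewrite /tmap (tlift_pure (tmap_act_bal g)) !f_Ft_pure iso.
Qed.

Definition tid_Ft (h : vseries V -> submod_Ft W) : tFt -> tens2 W :=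
  tlift (fun (u : submod_Ft W) (w : vseries V) => tpure u (h w)).

(* The polarization sum_(i, j) (v_i, v'_j) w_i (x) w'_j of T_W. *)
Definition momentB x z : tens2 W := tid_Ft (f_ b z) (to_Ft x).

Lemma tid_Ft_bal (h : {linear vseries V -> submod_Ft W}) :
  balanced (fun (u : submod_Ft W) (w : vseries V) => tpure u (h w)).
Proof.
split=> [u u' w|u w w'|p u w]; first exact: tpureDl.
  by rewrite linearD tpureDr.
by rewrite linearZ tpure_bal.
Qed.

Lemma tid_FtD (h : {linear vseries V -> submod_Ft W}) :
  {morph tid_Ft h : x y / x + y}.
Proof. exact: (tliftD (tid_Ft_bal h)). Qed.

Lemma tid_Ft_pure (h : {linear vseries V -> submod_Ft W}) u w :
  tid_Ft h (tpure u w) = tpure u (h w).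
Proof. exact: (tlift_pure (tid_Ft_bal h)). Qed.

Lemma momentBDl x y z : momentB (x + y) z = momentB x z + momentB y z.
Proof. by rewrite /momentB to_FtD tid_FtD. Qed.

Lemma momentB_pure (u : subvs_of W) (v : V) z :
  momentB (tpure u v) z = tpure (u : submod_Ft W) (f_ b z (vsC v)).
Proof. by rewrite /momentB to_Ft_pure tid_Ft_pure. Qed.

Lemma momentB0l z : momentB 0 z = 0.
Proof. by apply: (addrI (momentB 0 z)); rewrite -momentBDl !addr0. Qed.

Lemma momentB_suml (I : Type) (r : seq I) (G : I -> tF) z :
  momentB (\sum_(i <- r) G i) z = \sum_(i <- r) momentB (G i) z.
Proof. exact: (big_morph (momentB^~ z) (fun x y => momentBDl x y z) (momentB0l z)). Qed.

Lemma momentB_pure2 (u u' : subvs_of W) (v v' : V) :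
  momentB (tpure u v) (tpure u' v') =
  psC (b v v') *: tpure (u : submod_Ft W) (u' : submod_Ft W).
Proof. by rewrite momentB_pure f_pure vform_vsC symmC tpureZr. Qed.

Lemma momentBDr x y z : momentB x (y + z) = momentB x y + momentB x z.
Proof.
rewrite [x]tensE !momentB_suml -big_split /=; apply: eq_bigr => -[u v] _ /=.
by rewrite !momentB_pure f_Dl tpureDr.
Qed.

Lemma momentB_sumr (I : Type) (r : seq I) (G : I -> tF) x :
  momentB x (\sum_(i <- r) G i) = \sum_(i <- r) momentB x (G i).
Proof.
apply: (big_morph (momentB x) (momentBDr x)).
by apply: (addrI (momentB x 0)); rewrite -momentBDr !addr0.
Qed.

Lemma momentBZl (a : F) x z : momentB (a *: x) z = psC a *: momentB x z.
Proof.
rewrite [x]tensE scaler_sumr !momentB_suml scaler_sumr; apply: eq_bigr => -[u v] _ /=.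
by rewrite -tpureZl !momentB_pure -submod_actC tpureZl.
Qed.

Lemma momentBZr (a : F) x z : momentB x (a *: z) = psC a *: momentB x z.
Proof.
rewrite [z]tensE scaler_sumr !momentB_sumr scaler_sumr; apply: eq_bigr => -[u v] _ /=.
rewrite [x]tensE !momentB_suml scaler_sumr; apply: eq_bigr => -[u' v'] _ /=.
by rewrite -tpureZl !momentB_pure2 -submod_actC tpureZr !scalerA mulrC.
Qed.

Lemma T_momentB x : T_ b x = momentB x x.
Proof.
rewrite [x]tensE T_E momentB_suml; apply: eq_bigr => -[u v] _ /=.
by rewrite momentB_sumr; apply: eq_bigr => -[u' v'] _ /=; rewrite momentB_pure2.
Qed.

Lemma T_act g x : orthogonal_Ft b g -> T_ b (act_Ft g x) = T_ b x.
Proof.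
move=> hg; rewrite !T_momentB /momentB to_Ft_act; move: (to_Ft x) => X.
have gf : forall w, f_ b (act_Ft g x) (g w) = f_ b x w by move=> w; exact: f_act.
move: X; apply: tens_ext => [X Y|X Y|u w].
- by rewrite /tmap (tliftD (tmap_act_bal g)) tid_FtD.
- exact: tid_FtD.
- by rewrite /tmap (tlift_pure (tmap_act_bal g)) !tid_Ft_pure /= gf.
Qed.

Lemma tswap_bal : balanced (fun a c : submod_Ft W => tpure c a).
Proof. by split=> *; [exact: tpureDr | exact: tpureDl | rewrite tpure_bal]. Qed.

Lemma tswapD : {morph @tswap _ (submod_Ft W) : x y / x + y}.
Proof. exact: (tliftD tswap_bal). Qed.

Lemma tswap_pure (u u' : submod_Ft W) : tswap (tpure u u') = tpure u' u.
Proof. exact: (tlift_pure tswap_bal). Qed.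

Lemma tswap_sum (I : Type) (r : seq I) (G : I -> tens2 W) :
  tswap (\sum_(i <- r) G i) = \sum_(i <- r) tswap (G i).
Proof. exact: (tlift_sum tswap_bal). Qed.

Lemma tswap_momentB x z : tswap (momentB x z) = momentB z x.
Proof.
rewrite [x]tensE [z]tensE momentB_suml tswap_sum momentB_sumr.
apply: eq_bigr => -[u v] _ /=.
rewrite momentB_sumr tswap_sum momentB_suml; apply: eq_bigr => -[u' v'] _ /=.
by rewrite !momentB_pure2 -!tpureZl tswap_pure tpureZl tpureZr symmC.
Qed.

End Moments.

(** * Coordinate matrices of tensors and of the group action *)

Section Coordinates.
Variables (F : fieldType) (M : ntModule F) (V : vectType F) (b : {symmetric V}).
Variable W : submod M.

Local Notation tF := (tensF V W).
Local Notation m := (dim (subvs_of W)).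
Local Notation n := (dim V).
Implicit Types (x y z : tF) (g : {linear vseries V -> vseries V}) (w : subvs_of W).

Definition coordW w : 'cV[F]_m := (v2r w)^T.

Lemma coordW_linear : linear coordW.
Proof. by move=> a u v; rewrite /coordW !linearP. Qed.

HB.instance Definition _ :=
  GRing.isLinear.Build F (subvs_of W) 'cV[F]_m _ coordW coordW_linear.

Definition t_mul w : subvs_of W := psX F 1 *: (w : submod_Ft W).

Lemma t_mul_linear : linear t_mul.
Proof.
move=> a u v; rewrite /t_mul scalerDr; congr (_ + _).
by rewrite -!submod_actC !scalerA mulrC.
Qed.

HB.instance Definition _ :=
  GRing.isLinear.Build F (subvs_of W) (subvs_of W) _ t_mul t_mul_linear.

Definition t_mx : 'M[F]_m := (op_mx t_mul)^T.

Lemma coordW_X k w :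
  coordW (psX F k *: (w : submod_Ft W) : subvs_of W) = t_mx ^+ k *m coordW w.
Proof.
elim: k w => [|k IH] w; first by rewrite psX0 scale1r expr0 mul1mx.
have -> : psX F k.+1 = psX F k * psX F 1 by rewrite -psXD addn1.
rewrite -scalerA IH exprSr -mulmxE -mulmxA; congr (_ *m _).
by rewrite /coordW /t_mx -trmx_mul -v2r_op_mx.
Qed.

Lemma coordW_scale (p : pseries F) w :
  coordW (p *: (w : submod_Ft W) : subvs_of W) =
  \sum_(k < nt_idx M) p k *: (t_mx ^+ k *m coordW w).
Proof.
rewrite submod_actE linear_sum; apply: eq_bigr => k _.
by rewrite linearZ /= coordW_X.
Qed.

Lemma t_mx_nilp k : (nt_idx M <= k)%N -> t_mx ^+ k = 0.
Proof.
move=> le_k; apply/matrixP => i j.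
have := coordW_X k (r2v (delta_mx 0 j)); rewrite submod_actX0 // linear0.
rewrite /coordW r2vK trmx_delta -colE => /matrixP/(_ i 0).
by rewrite !mxE.
Qed.

Definition coord_mx : tF -> 'M[F]_(m, n) :=
  tlift (fun (w : subvs_of W) (v : V) => coordW w *m v2r v).

Lemma coord_mx_bal : balanced (fun (w : subvs_of W) (v : V) => coordW w *m v2r v).
Proof.
split=> [u u' v|u v v'|a u v]; first by rewrite linearD mulmxDl.
  by rewrite linearD mulmxDr.
by rewrite !linearZ /= -scalemxAl.
Qed.

Lemma coord_mxD : {morph coord_mx : x y / x + y}.
Proof. exact: (tliftD coord_mx_bal). Qed.

Lemma coord_mx_pure w (v : V) : coord_mx (tpure w v) = coordW w *m v2r v.
Proof. exact: (tlift_pure coord_mx_bal). Qed.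

Lemma coord_mx_sum (I : Type) (r : seq I) (G : I -> tF) :
  coord_mx (\sum_(i <- r) G i) = \sum_(i <- r) coord_mx (G i).
Proof. exact: (tlift_sum coord_mx_bal). Qed.

Definition tens_of_mx (X : 'M[F]_(m, n)) : tF :=
  \sum_i \sum_j X i j *: tpure (r2v (delta_mx 0 i) : subvs_of W) (r2v (delta_mx 0 j)).

Lemma coord_mxK : cancel coord_mx tens_of_mx.
Proof.
apply: (@tens_ext _ _ _ _ (tens_of_mx \o coord_mx) id) => [x y|x y|w v] //=.
  rewrite coord_mxD /tens_of_mx -big_split; apply: eq_bigr => i _.
  by rewrite -big_split; apply: eq_bigr => j _; rewrite mxE scalerDl.
rewrite coord_mx_pure /tens_of_mx [in RHS](vec_sum_delta w) tpure_suml.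
apply: eq_bigr => i _; rewrite [in RHS](vec_sum_delta v) tpure_sumr.
apply: eq_bigr => j _; rewrite tpureZl tpureZr scalerA.
by rewrite mxE big_ord1 mxE.
Qed.

Definition vs_coef g k (v : V) : V := g (vsC v) k.

Lemma psC_scale (a : F) (v : vseries V) k : ((psC a : pseries F) *: v) k = a *: v k.
Proof.
rewrite [LHS]/(vsZ _ _ _) big_ord_recl /= big1 => [|i _]; last by rewrite scale0r.
by rewrite subn0 addr0.
Qed.

Lemma vsC_linear (a : F) (u v : V) :
  vsC (a *: u + v) = (psC a : pseries F) *: (vsC u : vseries V) + vsC v.
Proof.
apply/funext => k; rewrite vseriesDE psC_scale.
by case: k => [|k] //=; rewrite scaler0 addr0.
Qed.

Lemma vs_coef_linear g k : linear (vs_coef g k).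
Proof. by move=> a u v; rewrite /vs_coef vsC_linear linearP vseriesDE psC_scale. Qed.

HB.instance Definition _ g k :=
  GRing.isLinear.Build F V V _ (vs_coef g k) (vs_coef_linear g k).

(** On constants g is the series sum_k t^k g_k with g_k = [vs_coef g k]; the factor t^k passes to W,
    where it vanishes for k >= [nt_idx M]. *)
Lemma coord_mx_act g x : coord_mx (act_Ft g x) =
  \sum_(k < nt_idx M) t_mx ^+ k *m coord_mx x *m op_mx (vs_coef g k).
Proof.
move: x; apply: tens_ext => [x y|x y|w v].
- by rewrite act_FtD coord_mxD.
- rewrite -big_split; apply: eq_bigr => k _.
  by rewrite coord_mxD mulmxDr mulmxDl.
rewrite act_Ft_pure coord_mx_sum; apply: eq_bigr => k _.
by rewrite !coord_mx_pure coordW_X -[g (vsC v) k]/(vs_coef g k v) v2r_op_mx !mulmxA.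
Qed.

Lemma coordW_f x (v : V) :
  coordW (f_ b x (vsC v)) = coord_mx x *m gram b *m (v2r v)^T.
Proof.
move: x; apply: tens_ext => [x y|x y|w v'].
- by rewrite f_Dl linearD.
- by rewrite coord_mxD !mulmxDl.
rewrite f_pure vform_vsC submod_actC linearZ coord_mx_pure /= gramE.
by rewrite -!mulmxA [X in _ = _ *m X]mx11_scalar mul_mx_scalar !mulmxA.
Qed.

Lemma coordW_eq0 (l : 'rV[F]_m) : (forall w, l *m coordW w = 0) -> l = 0.
Proof.
move=> l0; apply/rowP => j; have := l0 (r2v (delta_mx 0 j)).
by rewrite /coordW r2vK trmx_delta -colE => /matrixP/(_ 0 0); rewrite !mxE.
Qed.

(** Write v = v_0 + t v': the columns of X account for f_x(v_0), and tW contains the rest. *)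
Lemma coordW_f_kill x (l : 'rV[F]_m) (v : vseries V) :
  l *m t_mx = 0 -> l *m coord_mx x = 0 -> l *m coordW (f_ b x v) = 0.
Proof.
move=> lt lx; rewrite (vs_shift 1 v) linearD linearZ /= big_ord_recl big_ord0 addr0.
rewrite psX0 scale1r linearD mulmxDr /= coordW_f !mulmxA lx !mul0mx add0r.
by rewrite coordW_X expr1 mulmxA lt mul0mx.
Qed.

Lemma generating_surj x : (forall w, exists v, f_ b x v = w) ->
  generating t_mx (coord_mx x).
Proof.
move=> surj l lt lx; apply: coordW_eq0 => w; have [v <-] := surj w.
exact: coordW_f_kill.
Qed.

End Coordinates.

(** * Submersivity and surjectivity *)

(* A subspace of maximal dimension among those contained in P is all of P. *)
Lemma vspace_of_closed (F : fieldType) (U : vectType F) (P : set U) :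
  P 0 -> (forall a u v, P u -> P v -> P (a *: u + v)) ->
  exists X : {vspace U}, forall u, u \in X <-> P u.
Proof.
move=> P0 Plin.
pose Q d := `[< exists X : {vspace U}, (forall u, u \in X -> P u) /\ \dim X = d >].
have exQ : exists d, Q d.
  exists 0%N; apply/asboolP; exists 0%VS; split; last exact: dimv0.
  by move=> u; rewrite memv0 => /eqP->.
have ubQ d : Q d -> (d <= dim U)%N.
  by move=> /asboolP[X [_ <-]]; rewrite -(dimvf U) dimvS ?subvf.
case: (ex_maxnP exQ ubQ) => d /asboolP[X [XP dX]] maxd.
exists X => u; split; first exact: XP.
move=> Pu; apply/negPn/negP => uX.
have : (\dim (X + <[u]>) <= d)%N.
  apply: maxd; apply/asboolP; exists (X + <[u]>)%VS; split => // v.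
  move=> /memv_addP[x xX [_ /vlineP[a ->] ->]]; rewrite addrC.
  by apply: Plin => //; exact: XP.
rewrite -dX leqNgt => /negP; apply.
rewrite (ltn_leqif (dimv_leqif_eq (addvSl X <[u]>))).
apply: contra uX => /eqP ->; apply: (subvP (addvSr X <[u]>)).
exact: memv_line.
Qed.

Lemma mem_vs2mx (F : fieldType) (U : vectType F) (u : U) (X : {vspace U}) :
  (u \in X) = (v2r u <= vs2mx X)%MS.
Proof. by rewrite unfold_in /pred_of_vspace /= genmxE. Qed.

Section Surjectivity.
Variables (F : fieldType) (M : ntModule F) (V : vectType F) (b : {symmetric V}).
Hypothesis hb : nondegenerate b.
Variable W : submod M.

Local Notation tF := (tensF V W).
Local Notation m := (dim (subvs_of W)).
Implicit Types (x y z : tF).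

(* Nakayama's lemma, dually: a functional killing the image of f_x is pushed by *)
(* powers of t, which are nilpotent, into the functionals killed by t.          *)
Lemma surj_generating x : generating (t_mx W) (coord_mx x) ->
  forall w : subvs_of W, exists v, f_ b x v = w.
Proof.
move=> gen; pose P : set (subvs_of W) := [set w | exists v, f_ b x v = w].
have [||X XP] := @vspace_of_closed F (subvs_of W) P.
- by exists 0; rewrite linear0.
- move=> a _ _ [u <-] [v <-]; exists ((psC a : pseries F) *: u + v).
  by rewrite linearP /= submod_actC.
suff lX0 (l : 'rV[F]_m) : (forall w, w \in X -> l *m coordW w = 0) -> l = 0.
  move=> w; apply/XP; rewrite mem_vs2mx submxE; apply/negPn/negP.
  move=> /rV0Pn[j /eqP nz]; apply: nz.
  pose l := (col j (cokermx (vs2mx X)))^T.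
  have lE (u : subvs_of W) : l *m coordW u = (col j (v2r u *m cokermx (vs2mx X)))^T.
    by rewrite /l /coordW -trmx_mul !colE mulmxA.
  have : l *m coordW w = 0.
    rewrite (lX0 l) ?mul0mx // => u; rewrite mem_vs2mx submxE lE => /eqP ->.
    by rewrite col0 trmx0.
  by rewrite lE => /matrixP/(_ 0 0); rewrite !mxE.
move=> lX; suff lt k : l *m t_mx W ^+ (nt_idx M - k) = 0.
  by have := lt (nt_idx M); rewrite subnn expr0 mulmx1.
(* Descending induction on the power of t: if l t^(j+1) = 0, then l t^j kills tW, and it kills Im
   f_x because that image is stable under t. *)
elim: k => [|k IH]; first by rewrite t_mx_nilp ?mulmx0 // subn0.
have [le_k|lt_k] := leqP (nt_idx M) k.
  by move: le_k IH; rewrite subnS -subn_eq0 => /eqP ->.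
apply: gen; first by rewrite -mulmxA mulmxE -exprSr subnSK.
have fX v : l *m t_mx W ^+ (nt_idx M - k.+1) *m coordW (f_ b x v) = 0.
  rewrite -mulmxA -coordW_X lX //; apply/XP.
  by eexists; rewrite -linearZ.
(* On constant series f_x has matrix X S; S being invertible, a functional killing Im f_x kills
   X. *)
apply: (can_inj (mulmxK (gram_unit hb))); rewrite mul0mx -mulmxA.
apply/rowP => j; have := fX (vsC (r2v (delta_mx 0 j))).
rewrite coordW_f r2vK trmx_delta !mulmxA -colE => /matrixP/(_ 0 0).
by rewrite mxE [X in _ = X -> _]mxE => ->; rewrite mxE.
Qed.

End Surjectivity.

(** * Functionals on the tensor square of W *)

Section Functionals.
Variables (F : fieldType) (M : ntModule F) (V : vectType F) (b : {symmetric V}).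
Variable W : submod M.

Local Notation tF := (tensF V W).
Local Notation m := (dim (subvs_of W)).
Local Notation N := (t_mx W).
Implicit Types (x y z : tF) (w : subvs_of W).

Section Pairing.
Variables (k : nat) (l l' : 'rV[F]_m).

(* (w, w') |-> sum_(i + j = k) l(t^i w) l'(t^j w'), which is F[[t]]-balanced as *)
(* soon as l and l' kill t^(k+1).                                               *)
Definition pairing_phi w w' : F :=
  (l *m twist_mx N k (coordW w *m (coordW w')^T) *m l'^T) 0 0.

Definition pairing : tens2 W -> F :=
  tlift (fun u u' : submod_Ft W => pairing_phi (u : subvs_of W) (u' : subvs_of W)).

Hypothesis lN : l *m N ^+ k.+1 = 0.
Hypothesis l'N : l' *m N ^+ k.+1 = 0.

Lemma pairing_bal : balanced (fun u u' : submod_Ft W =>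
  pairing_phi (u : subvs_of W) (u' : subvs_of W)).
Proof.
have phiE (A : 'M[F]_m) (a : F) :
  (l *m twist_mx N k (a *: A) *m l'^T) 0 0 = a * (l *m twist_mx N k A *m l'^T) 0 0.
  by rewrite linearZ /= -scalemxAr -scalemxAl mxE.
have phiD (A B : 'M[F]_m) : (l *m twist_mx N k (A + B) *m l'^T) 0 0 =
  (l *m twist_mx N k A *m l'^T) 0 0 + (l *m twist_mx N k B *m l'^T) 0 0.
  by rewrite linearD /= mulmxDr mulmxDl mxE.
split=> [u u' v|u v v'|p u v]; rewrite /pairing_phi.
- by rewrite linearD mulmxDl phiD.
- by rewrite linearD [(_ + _)^T]linearD mulmxDr phiD.
have vE : (coordW (p *: v : subvs_of W))^T =
    \sum_(i < nt_idx M) p i *: (N ^+ i *m coordW v)^T.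
  by rewrite coordW_scale linear_sum; apply: eq_bigr => i _; rewrite linearZ.
rewrite vE coordW_scale mulmx_suml [coordW u *m \sum_(_ < _) _]mulmx_sumr.
rewrite !(linear_sum (twist_mx N k)) /=.
rewrite ![l *m (\sum_(_ < _) _)]mulmx_sumr ![(\sum_(_ < _) _) *m l'^T]mulmx_suml !summxE.
apply: eq_bigr => j _.
rewrite -[(_ *: _) *m _]scalemxAl -[coordW u *m (_ *: _)]scalemxAr.
rewrite [LHS]phiE [RHS]phiE; congr (_ * _).
rewrite trmx_mul -[_ *m _ *m (coordW v)^T]mulmxA twist_mx_shift //.
by rewrite -[_ *m _ *m (N ^+ j)^T]mulmxA.
Qed.

Lemma pairingD : {morph pairing : x y / x + y}.
Proof. exact: (tliftD pairing_bal). Qed.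

Lemma pairing_pure w w' :
  pairing (tpure (w : submod_Ft W) (w' : submod_Ft W)) = pairing_phi w w'.
Proof. exact: (tlift_pure pairing_bal). Qed.

Lemma pairingZ (a : F) (s : tens2 W) : pairing (psC a *: s) = a * pairing s.
Proof.
move: s; apply: tens_ext => [x y|x y|u v].
- by rewrite scalerDr pairingD.
- by rewrite pairingD mulrDr.
rewrite -tpureZl submod_actC !pairing_pure /pairing_phi linearZ /= -scalemxAl.
by rewrite linearZ /= -scalemxAr -scalemxAl mxE.
Qed.

Lemma pairing_momentB x z : pairing (momentB b x z) =
  (l *m twist_mx N k (coord_mx x *m gram b *m (coord_mx z)^T) *m l'^T) 0 0.
Proof.
move: x; apply: tens_ext => [x y|x y|w v].
- by rewrite momentBDl pairingD.
- by rewrite coord_mxD !mulmxDl linearD /= mulmxDr mulmxDl mxE.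
rewrite momentB_pure pairing_pure /pairing_phi coordW_f coord_mx_pure.
congr (fun_of_matrix (_ *m twist_mx _ _ _ *m _) 0 0).
by rewrite !trmx_mul trmxK gram_sym !mulmxA.
Qed.

End Pairing.

Lemma same_moment_T x y : T_ b x = T_ b y ->
  same_moment (gram b) N (coord_mx x) (coord_mx y).
Proof.
move=> eqT k l l' lN l'N.
by rewrite /moment_mx -!pairing_momentB // -!T_momentB eqT.
Qed.

End Functionals.

(** In characteristic 0 the elements 0, ..., size p - 1 are distinct, which makes too many roots. *)
Lemma poly_vanishing_eq0 (F : fieldType) (p : {poly F}) : [pchar F] =i pred0 ->
  (forall a, p.[a] = 0) -> p = 0.
Proof.
move=> F0 p0; apply/eqP; apply/negPn/negP => nz.
pose rs : seq F := [seq i%:R | i <- iota 0 (size p)].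
have := max_poly_roots nz (_ : all (root p) rs) (_ : uniq rs).
rewrite size_map size_iota ltnn; move=> h; suff: false by [].
apply: h; first by apply/allP => a _; rewrite /root p0.
rewrite map_inj_uniq ?iota_uniq //; have /pcharf0P char0 := F0.
suff natr_inj i j : (i <= j)%N -> i%:R = j%:R :> F -> i = j.
  move=> i j /= eq_ij.
  by have [/natr_inj/(_ eq_ij)|/ltnW/natr_inj/(_ (esym eq_ij))/esym] := leqP i j.
move=> le_ij /esym/eqP; rewrite -subr_eq0 -natrB // char0 subn_eq0 => le_ji.
by apply/eqP; rewrite eqn_leq le_ij.
Qed.

(** * The differential of the moment map *)

Section Submersion.
Variables (F : fieldType) (M : ntModule F) (V : vectType F) (b : {symmetric V}).
Hypothesis F0 : [pchar F] =i pred0.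
Variable W : submod M.

Local Notation tF := (tensF V W).
Local Notation m := (dim (subvs_of W)).
Local Notation N := (t_mx W).
Local Notation T2 := (restrict_scalars (tens2 W)).
Implicit Types (x y z : tF) (w : subvs_of W).

Definition dT x z : T2 := momentB b x z + momentB b z x.

Lemma dT_linear x : linear (dT x).
Proof.
move=> a y z; rewrite /dT momentBDr momentBDl momentBZr momentBZl addrACA.
by rewrite -scalerDr.
Qed.

HB.instance Definition _ x := GRing.isLinear.Build F tF T2 _ (dT x) (dT_linear x).

Lemma T_expand x z (a : F) :
  T_ b (x + a *: z) = T_ b x + a *: dT x z + a ^+ 2 *: T_ b z.
Proof.
have -> : a ^+ 2 *: T_ b z = psC a *: (psC a *: momentB b z z).
  by rewrite T_momentB scalerA -psCM -expr2.
have -> : a *: dT x z = psC a *: momentB b x z + psC a *: momentB b z x.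
  by rewrite -scalerDr.
by rewrite !T_momentB momentBDl !momentBDr !momentBZl !momentBZr !addrA.
Qed.

(** B(-, x) is id (x) f_x on W (x) V[[t]], so a preimage is built term by term. *)
Lemma momentB_onto x : (forall w, exists v, f_ b x v = w) ->
  forall s : tens2 W, exists z, momentB b z x = s.
Proof.
move=> surj s; rewrite [s]tensE; elim: (tens_repr s) => [|[w w'] r [z zE]].
  by exists 0; rewrite big_nil momentB0l.
have [v vE] := surj w'; exists (of_Ft (tpure (w : submod_Ft W) v) + z).
by rewrite big_cons momentBDl zE /momentB of_FtK tid_Ft_pure /= vE.
Qed.

Lemma surj_submersive x : (forall w, exists v, f_ b x v = w) ->
  @submersive_at F tF T2 (@S2t F M W) (T_ b) x.
Proof.
move=> surj; exists (dT x).
  by move=> z; exists [:: T_ b z] => a; rewrite T_expand big_ord1.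
apply/seteqP; split=> [_ [z _ <-]|s sS].
  by rewrite /S2t /symmetric_tensors /= /dT tswapD !tswap_momentB addrC.
(* If B(z, x) = s then B(x, z) is the swap of s, which is s again; hence the factor 1/2. *)
have [z zE] := momentB_onto surj s; exists (2%:R^-1 *: z) => //=.
rewrite linearZ /= /dT -(tswap_momentB _ z x) zE sS.
have two0 : 2%:R != 0 :> F by have /pcharf0P -> := F0.
transitivity ((psC 2%:R^-1 : pseries F) *: (s + s)); first by [].
rewrite scalerDr -scalerDl -psC_is_additive (_ : _ + _ = 1) ?scale1r //.
by rewrite -mulr2n -[_^-1 *+ 2]mulr_natl divff.
Qed.

(** If l kills tW and x, then l (x) l kills both B(x, z) and B(z, x), hence the range of the
    differential. That range contains w (x) w, on which l (x) l takes the value l(w)^2. *)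
Lemma submersive_generating x :
  @submersive_at F tF T2 (@S2t F M W) (T_ b) x -> generating N (coord_mx x).
Proof.
case=> L diffL rangeL l lN lx.
have lN1 : l *m N ^+ 0.+1 = 0 by rewrite expr1.
pose phi := pairing 0 l l : tens2 W -> F.
have phiD : {morph phi : s s' / s + s'} := pairingD lN1 lN1.
have phiZ a s : phi ((a : F) *: (s : T2)) = a * phi s := pairingZ lN1 lN1 a s.
have phi0 : phi 0 = 0 by apply: (addrI (phi 0)); rewrite -phiD !addr0.
have phi_dT z : phi (dT x z) = 0.
  rewrite /dT phiD /phi !pairing_momentB // /twist_mx !big_ord1 expr0 trmx1.
  rewrite !mul1mx !mulmx1 !mulmxA lx !mul0mx -!mulmxA -trmx_mul lx trmx0 !mulmx0.
  by rewrite mxE addr0.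
have phiL y : phi (L y) = 0.
  have [c cE] := diffL y.
  (* L is known only through a polynomial identity in a. Applying [phi] and comparing with
     [T_expand] makes p vanish at every a, and its coefficient of degree 1 is phi (L y). *)
  pose p : {poly F} := (phi (L y)) *: 'X
     + \sum_(k < size c) phi c`_k *: 'X^(k.+2) - phi (T_ b y) *: 'X^2.
  have p0 : p = 0.
    apply: poly_vanishing_eq0 => // a.
    rewrite /p !hornerD hornerN !hornerZ hornerX hornerXn horner_sum.
    have := cE a; rewrite T_expand -!addrA => /addrI /(congr1 phi).
    move: (T_ b y) => Ty; rewrite !phiD !phiZ phi_dT mulr0 add0r.
    rewrite (big_morph phi phiD phi0) [phi Ty * _]mulrC => ->.
    rewrite [phi (L y) * a]mulrC addrCA opprD addNKr -sumrB big1 // => k _.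
    by rewrite phiZ hornerZ hornerXn mulrC subrr.
  have := congr1 (fun q : {poly F} => q`_1) p0.
  rewrite /p coefB coefD !coefZ coefX coefXn coef_sum big1 => [|i _].
    by rewrite coef0 mulr1 addr0 mulr0 subr0.
  by rewrite coefZ coefXn mulr0.
apply: coordW_eq0 => w.
have : @S2t F M W (tpure (w : submod_Ft W) (w : submod_Ft W)).
  by rewrite /S2t /symmetric_tensors /= tswap_pure.
rewrite -rangeL => -[y _ yE]; have := phiL y; rewrite yE /phi pairing_pure //.
rewrite /pairing_phi /twist_mx big_ord1 expr0 trmx1 mulmx1 mul1mx.
rewrite mulmxA -mulmxA -trmx_mul [l *m coordW w]mx11_scalar.
rewrite tr_scalar_mx -scalar_mxM mxE eqxx => /eqP; rewrite mulf_eq0 orbb => /eqP ->.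
by rewrite raddf0.
Qed.

End Submersion.

(** * The group G(F[[t]]) *)

Section OrthogonalGroup.
Variables (F : fieldType) (V : vectType F) (b : {symmetric V}).
Local Notation n := (dim V).
Implicit Types (g h : {linear vseries V -> vseries V}) (A : 'M[F]_n).

Lemma orthogonal_Ft_id : orthogonal_Ft b (idfun : vseries V -> vseries V).
Proof. by split => //; exists id. Qed.

Lemma orthogonal_Ft_comp g h :
  orthogonal_Ft b g -> orthogonal_Ft b h -> orthogonal_Ft b (g \o h).
Proof.
move=> [bg ig] [bh ih]; split; first exact: bij_comp.
by move=> v w; rewrite /= ig ih.
Qed.

Lemma orthogonal_Ft_inv g : orthogonal_Ft b g ->
  exists2 h : {linear vseries V -> vseries V}, orthogonal_Ft b h & cancel g h.
Proof.
move=> [bg ig]; have [h gK hK] := linear_inverse bg; exists h => //.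
split; first by exists g.
by move=> v w; rewrite -[in RHS](hK v) -[in RHS](hK w) ig.
Qed.

Definition mx_op A (v : V) : V := r2v (v2r v *m A).

Lemma mx_op_linear A : linear (mx_op A).
Proof. by move=> a u v; rewrite /mx_op !linearP mulmxDl -scalemxAl linearP. Qed.

HB.instance Definition _ A := GRing.isLinear.Build F V V _ (mx_op A) (mx_op_linear A).

Lemma eq_op_mx A (f : {linear V -> V}) : f =1 mx_op A -> op_mx f = A.
Proof.
move=> fE; apply/row_matrixP => i; rewrite !rowE -[delta_mx 0 i]r2vK.
by rewrite -v2r_op_mx fE /mx_op !r2vK.
Qed.

Lemma orthogonal_vsmap A : gram b \in unitmx -> isometry_mx (gram b) A ->
  orthogonal_Ft b (vsmap (mx_op A)).
Proof.
move=> Gu iso; have Au := isometry_mx_unit Gu iso; split.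
  exists (vsmap (mx_op (invmx A))) => v; apply/funext => k.
    by rewrite /vsmap /= /mx_op r2vK mulmxK // v2rK.
  by rewrite /vsmap /= /mx_op r2vK mulmxKV // v2rK.
move=> v w; apply/funext => k; apply: eq_bigr => i _.
by rewrite /vsmap !gramE /mx_op !r2vK isometry_mxK.
Qed.

Section Shear.
Variables (k : nat) (a : {linear V -> V}).

Definition shear (v : vseries V) : vseries V := v + psX F k *: vsmap a v.

Lemma shear_linear : linear shear.
Proof.
move=> p u v; rewrite /shear linearP !scalerDr !scalerA mulrC addrACA.
by rewrite [_ + psX F k *: _]addrC.
Qed.

HB.instance Definition _ :=
  GRing.isLinear.Build (pseries F) (vseries V) (vseries V) _ shear shear_linear.

Lemma shearE v j : shear v j = v j + if (k <= j)%N then a (v (j - k)%N) else 0.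
Proof. by rewrite /shear vseriesDE psX_scale. Qed.

(** Solves (1 + t^k a) u = v by u_j = v_j - a(u_{j-k}). As k > 0 the index drops at each call, so
    fuel j + 1 is enough at index j. *)
Fixpoint unshear_rec (v : vseries V) fuel j : V :=
  if fuel is f.+1 then
    v j - if (k <= j)%N then a (unshear_rec v f (j - k)%N) else 0
  else 0.

Hypothesis k_gt0 : (0 < k)%N.

Lemma unshear_rec_stable v f f' j : (j < f)%N -> (j < f')%N ->
  unshear_rec v f j = unshear_rec v f' j.
Proof.
elim: f f' j => // f IH [|f'] //= j; rewrite !ltnS => jf jf'.
case: leqP => // le_kj.
have lt_j : (j - k < j)%N by rewrite ltn_subrL k_gt0 (leq_trans k_gt0).
by rewrite (IH f') ?(leq_trans lt_j).
Qed.

Lemma shear_bij : bijective shear.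
Proof.
have shearK v : shear (fun j => unshear_rec v j.+1 j) = v.
  apply/funext => j; rewrite shearE /=.
  case: leqP => [le_kj|_]; last by rewrite subr0 addr0.
  rewrite (@unshear_rec_stable v j (j - k).+1 (j - k)%N) ?subrK //.
  by rewrite ltn_subrL k_gt0 (leq_trans k_gt0).
have inj : injective shear.
  move=> u v uv; apply/funext => j.
  elim/ltn_ind: j => j IH; move: (congr1 (fun w : vseries V => w j) uv).
  rewrite /= !shearE; case: leqP => [le_kj|_]; last by rewrite !addr0.
  rewrite (IH (j - k)%N); first exact: addIr.
  by rewrite ltn_subrL k_gt0 (leq_trans k_gt0).
exists (fun v j => unshear_rec v j.+1 j) => // v.
by apply: inj; rewrite shearK.
Qed.

End Shear.

Lemma vform_shear k (a : {linear V -> V}) (u v : vseries V) :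
  vform b (shear k a u) (shear k a v) = vform b u v
   + psX F k * (vform b (vsmap a u) v + vform b u (vsmap a v))
   + psX F k * psX F k * vform b (vsmap a u) (vsmap a v).
Proof.
rewrite /shear vformDl !vformDr !vformZl !vformZr.
ring.
Qed.

(* The Cayley transform (1 + t^k a)(1 - t^k a)^-1 of t^k a, with a = Xi / 2. *)
Lemma cayley k (Xi : 'M[F]_n) : 2%:R != 0 :> F -> (0 < k)%N ->
  Xi *m gram b + gram b *m Xi^T = 0 ->
  exists2 g : {linear vseries V -> vseries V}, orthogonal_Ft b g &
    [/\ forall v, g (vsC v) 0%N = v,
        forall v j, (0 < j < k)%N -> g (vsC v) j = 0
      & forall v, g (vsC v) k = mx_op Xi v].
Proof.
move=> two0 k0 skew; pose A := 2%:R^-1 *: Xi.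
pose a := mx_op A; pose a' := mx_op (- A).
have aN v : a' v = - a v by rewrite /a' /a /mx_op mulmxN linearN.
have [h' hK h'K] := linear_inverse (shear_bij a' k0).
have AG : A *m gram b + gram b *m A^T = 0.
  by rewrite /A linearZ /= -scalemxAl -scalemxAr -scalerDr skew scaler0.
have skew_a u v : b (a u) v + b u (a v) = 0.
  have := congr1 (fun B => (v2r u *m B *m (v2r v)^T) 0 0) AG.
  rewrite mulmxDr mulmxDl mxE mulmx0 mul0mx [RHS]mxE => <-.
  by rewrite !gramE /a /mx_op !r2vK trmx_mul !mulmxA.
have skew_vs u v : vform b (vsmap a u) v + vform b u (vsmap a v) = 0.
  apply/funext => j; rewrite [LHS]/(psD _ _ _) /psD /vform -big_split.
  by rewrite big1 // => i _; exact: skew_a.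
have vsN u : vsmap a' u = - vsmap a u by apply/funext => j; exact: aN.
exists (shear k a \o h').
  split; first by apply: bij_comp; [exact: shear_bij | exists (shear k a')].
  move=> v w; rewrite /= -[in RHS](h'K v) -[in RHS](h'K w).
  (* As a is skew, the shears by a and by -a change the form by the same term t^(2k) [a u, a v]. *)
  rewrite !vform_shear !vsN skew_vs.
  by rewrite -!scaleN1r !vformZl !vformZr !mulN1r opprK -opprD skew_vs oppr0.
have hE v j : h' (vsC v) j =
    vsC v j - (if (k <= j)%N then a' (h' (vsC v) (j - k)%N) else 0).
  have e : shear k a' (h' (vsC v)) = vsC v := h'K _.
  by move: (shearE k a' (h' (vsC v)) j); rewrite e => ->; rewrite addrK.
have h0 v : h' (vsC v) 0%N = v by rewrite hE leqNgt k0 subr0.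
split=> [v|v j /andP[j0 jk]|v] /=; rewrite shearE.
- by rewrite h0 leqNgt k0 addr0.
- by rewrite hE leqNgt jk /= subr0 addr0; case: j j0 {jk}.
(* The numerator and the inverted denominator each contribute a to the coefficient of t^k, and a + a
   = Xi. *)
- rewrite hE leqnn subnn h0 aN opprK; case: k k0 {h0 hE h' hK h'K} => // k' _ /=.
  rewrite add0r /a /A /mx_op -linearD -mulmxDr -scalerDl.
  by rewrite -mulr2n -[_^-1 *+ 2]mulr_natl divff // scale1r.
Qed.

End OrthogonalGroup.

(** * Orbits *)

Section Orbits.
Variables (F : fieldType) (M : ntModule F) (V : vectType F) (b : {symmetric V}).
Variable W : submod M.

Local Notation tF := (tensF V W).
Implicit Types (x y z : tF) (g : {linear vseries V -> vseries V}).

Lemma orbit_refl x : orbit_Ft b x x.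
Proof.
by exists (idfun : vseries V -> vseries V); [exact: orthogonal_Ft_id | exact: act_Ft_id].
Qed.

Lemma orbit_sym x y : orbit_Ft b x y -> orbit_Ft b y x.
Proof.
case=> g og <-; have [h oh gK] := orthogonal_Ft_inv og; exists h => //.
rewrite -act_Ft_comp -[RHS]act_Ft_id; exact: eq_act_Ft.
Qed.

Lemma orbit_trans x y z : orbit_Ft b x y -> orbit_Ft b y z -> orbit_Ft b x z.
Proof.
case=> g og <- [h oh <-]; exists (h \o g); first exact: orthogonal_Ft_comp.
exact: act_Ft_comp.
Qed.

Lemma eq_orbit x y : orbit_Ft b x y -> orbit_Ft b x = orbit_Ft b y.
Proof.
move=> xy; apply/seteqP; split=> z; last exact: orbit_trans.
by apply: orbit_trans; exact: orbit_sym.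
Qed.

Definition f_onto x := forall w : subvs_of W, exists v, f_ b x v = w.

Lemma f_onto_orbit x y : orbit_Ft b x y -> f_onto x -> f_onto y.
Proof.
by case=> g og <- ontox w; have [v <-] := ontox w; exists (g v); exact: f_act.
Qed.

Lemma T_orbit x y : orbit_Ft b x y -> T_ b x = T_ b y.
Proof. by case=> g og <-; rewrite T_act. Qed.

(** Only the term k = 0 of [coord_mx_act] is nonzero; positivity of [nt_idx M] ensures that the sum
    contains it. *)
Lemma coord_mx_act_const A x : (0 < nt_idx M)%N ->
  coord_mx (act_Ft (vsmap (mx_op A)) x) = coord_mx x *m A.
Proof.
rewrite coord_mx_act; case: (nt_idx M) => // p _.
rewrite big_ord_recl big1 ?addr0 => [|i _]; last first.
  rewrite (@eq_op_mx _ _ 0) ?mulmx0 // => v.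
  by transitivity (mx_op A 0); rewrite // linear0 /mx_op mulmx0 linear0.
by rewrite expr0 mul1mx (@eq_op_mx _ _ A).
Qed.

Lemma coord_mx_act_shear g A k x : (0 < k < nt_idx M)%N ->
    (forall v, g (vsC v) 0%N = v) ->
    (forall v j, (0 < j < k)%N -> g (vsC v) j = 0) ->
    (forall v, g (vsC v) k = mx_op A v) ->
  exists R, coord_mx (act_Ft g x) = coord_mx x + t_mx W ^+ k *m coord_mx x *m A
                                   + t_mx W ^+ k.+1 *m R.
Proof.
move=> /andP[k0 lt_k] g0 gj gk; rewrite coord_mx_act.
pose G j := t_mx W ^+ j *m coord_mx x *m op_mx (vs_coef g j).
(* The tail of the series of g, with t^(k+1) factored out. *)
exists (\sum_(k.+1 <= j < nt_idx M)
  t_mx W ^+ (j - k.+1) *m coord_mx x *m op_mx (vs_coef g j)).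
rewrite -(big_mkord xpredT G) (big_cat_nat _ (n := k.+1)) //=; congr (_ + _).
  rewrite big_nat_recr //= big_ltn // big_nat big1 => [|j jk]; last first.
    rewrite /G (@eq_op_mx _ _ 0) ?mulmx0 // => v.
    by rewrite -[LHS]/(g (vsC v) j) gj // /mx_op mulmx0 linear0.
  rewrite addr0 /G expr0 mul1mx (@eq_op_mx _ _ 1%:M) => [|v]; last first.
    by rewrite -[LHS]/(g (vsC v) 0%N) g0 /mx_op mulmx1 v2rK.
  by rewrite mulmx1 (@eq_op_mx _ _ A).
rewrite mulmx_sumr; apply: eq_big_nat => j /andP[kj _].
by rewrite !mulmxA mulmxE -exprD subnKC.
Qed.

Hypothesis hb : nondegenerate b.
Hypothesis two_neq0 : 2%:R != 0 :> F.

Theorem orbit_of_moment x y : f_onto x -> f_onto y -> T_ b x = T_ b y ->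
  orbit_Ft b x y.
Proof.
move=> ontox ontoy eqT.
have Gu := gram_unit hb; have Gs := gram_sym b.
(* Points of the orbit of x approach y modulo t^k; since t^(nt_idx) kills W, the last of them is
   y. *)
suff approx k : (k <= nt_idx M)%N -> exists2 x', orbit_Ft b x x' &
    exists Z, coord_mx y = coord_mx x' + t_mx W ^+ k *m Z.
  have [x' xx' [Z]] := approx _ (leqnn _).
  rewrite t_mx_nilp // mul0mx addr0 => /(can_inj (@coord_mxK _ _ _ _)) ->.
  exact: xx'.
elim: k => [_|k IH lt_k].
  exists x; first exact: orbit_refl.
  by exists (coord_mx y - coord_mx x); rewrite expr0 mul1mx addrC subrK.
have [x' xx' [Z yE]] := IH (ltnW lt_k).
have genx' := generating_surj (f_onto_orbit xx' ontox).
have sm : same_moment (gram b) (t_mx W) (coord_mx x') (coord_mx y).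
  by apply: same_moment_T; rewrite -(T_orbit xx').
have [k0|k_gt0] := posnP k.
  have [g iso [Q yQ]] := lift_start Gs Gu two_neq0 genx' (generating_surj ontoy) sm.
  exists (act_Ft (vsmap (mx_op g)) x').
    apply: (orbit_trans xx'); exists (vsmap (mx_op g)) => //.
    exact: orthogonal_vsmap.
  exists Q; rewrite coord_mx_act_const ?yQ ?k0 ?expr1 //.
  exact: leq_trans lt_k.
have [Xi skew [Q yQ]] := lift_step Gs Gu k_gt0 genx' sm yE.
have [g og [g0 gj gk]] := cayley two_neq0 k_gt0 skew.
have [|R RE] := @coord_mx_act_shear g Xi k x' _ g0 gj gk; first by rewrite k_gt0.
exists (act_Ft g x'); first by apply: (orbit_trans xx'); exists g.
exists (Q - R); rewrite RE yQ mulmxBr -[RHS]addrA; congr (_ + _).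
by rewrite addrC subrK.
Qed.

End Orbits.

(** * Change of submodule *)

Section Inclusion.
Variables (F : fieldType) (M : ntModule F) (V : vectType F) (b : {symmetric V}).
Variables (L W : submod M).
Hypothesis WL : Gr L W.

Local Notation incl := (@tens_incl F M V W L).

Lemma tens_inclD : {morph incl : x y / x + y}.
Proof. exact: (tliftD (tens_incl_bal V W L)). Qed.

Lemma tens_incl_pure (w : subvs_of W) (v : V) :
  incl (tpure w v) = tpure (vsproj L (vsval w)) v.
Proof. exact: (tlift_pure (tens_incl_bal V W L)). Qed.

Lemma tens_incl_sum (I : Type) (r : seq I) (G : I -> tensF V W) :
  incl (\sum_(i <- r) G i) = \sum_(i <- r) incl (G i).
Proof. exact: (tlift_sum (tens_incl_bal V W L)). Qed.

Lemma vsproj_scale (p : pseries F) (w : subvs_of W) :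
  vsproj L (vsval (p *: (w : submod_Ft W) : subvs_of W)) =
  p *: (vsproj L (vsval w) : submod_Ft L) :> subvs_of L.
Proof.
have wL : vsval w \in (L : {vspace M}) by apply: (subvP WL); exact: subvsP.
apply: val_inj; rewrite /= !val_submod_act vsprojK; first by rewrite vsprojK.
exact: submodP.
Qed.

Lemma tens_incl_act g y : incl (act_Ft g y) = act_Ft g (incl y).
Proof.
move: y; apply: tens_ext => [x y|x y|w v].
- by rewrite act_FtD tens_inclD.
- by rewrite tens_inclD act_FtD.
rewrite act_Ft_pure tens_incl_sum tens_incl_pure act_Ft_pure.
by apply: eq_bigr => k _; rewrite tens_incl_pure vsproj_scale.
Qed.

Lemma f_tens_incl y v : vsval (f_ b (incl y) v) = vsval (f_ b y v).
Proof.
move: y; apply: tens_ext => [x y|x y|w v'].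
- by rewrite tens_inclD f_Dl.
- by rewrite f_Dl.
by rewrite tens_incl_pure !f_pure -vsproj_scale vsprojK // (subvP WL) // subvsP.
Qed.

End Inclusion.

(** * The correspondence between orbits and pairs *)

Section Classification.
Variables (F : fieldType) (M : ntModule F) (V : vectType F) (b : {symmetric V}).
Hypothesis hb : nondegenerate b.
Hypothesis F0 : [pchar F] =i pred0.
Variable L : submod M.
Implicit Types (x : tensF V L) (Wi : {W : submod M & tens2 W}).

(** The rows of the inverse Gram matrix are the basis dual to the standard one for the form. The
    expansion shows that x lies in Im f_x (x) V. *)
Lemma tensor_dual_basis x : x =
  \sum_j tpure (f_ b x (vsC (r2v (row j (invmx (gram b))))) : subvs_of L)
               (r2v (delta_mx 0 j)).
Proof.
move: x; apply: (@tens_ext _ _ _ _ id) => // [x y|w v].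
  by rewrite -big_split; apply: eq_bigr => j _; rewrite f_Dl tpureDl.
rewrite [in LHS](vec_sum_delta v) tpure_sumr; apply: eq_bigr => j _.
rewrite f_pure vform_vsC submod_actC tpure_bal; congr (tpure _ (_ *: _)).
rewrite gramE r2vK tr_row trmx_inv gram_sym colE mulmxA mulmxK ?gram_unit //.
by rewrite -colE mxE.
Qed.

(** A relation, because the type of the second component depends on the first. The preimage y of x
    over W carries both conditions. *)
Definition orbit_pair x Wi := exists y : tensF V (projT1 Wi),
  [/\ Gr L (projT1 Wi), tens_incl L y = x, f_onto b y & T_ b y = projT2 Wi].

Lemma orbit_pair_image x Wi : orbit_pair x Wi -> forall u : M,
  u \in (projT1 Wi : {vspace M}) <-> exists v, vsval (f_ b x v) = u.
Proof.
case: Wi => W i [y /= [WL yx onto _]] u; split=> [uW|[v <-]].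
  have [v vE] := onto (vsproj W u); exists v.
  by rewrite -yx f_tens_incl // vE vsprojK.
by rewrite -yx f_tens_incl //; exact: subvsP.
Qed.

Lemma orbit_pair_exists x : exists Wi, orbit_pair x Wi.
Proof.
pose P : set M := [set u | exists v, vsval (f_ b x v) = u].
have [||X XP] := @vspace_of_closed F M P.
- by exists 0; rewrite linear0.
- move=> a _ _ [u <-] [v <-]; exists ((psC a : pseries F) *: u + v).
  by rewrite linearP /= submod_actC.
have Xact : `[< forall p u, u \in X -> nt_act p u \in X >].
  apply/asboolP => p u /XP[v <-]; apply/XP; exists (p *: v).
  by rewrite linearZ /= val_submod_act.
pose W : submod M := Submod Xact.
have WL : Gr L W by apply/subvP => u /XP[v <-]; exact: subvsP.
pose y : tensF V W := \sum_j
  tpure (vsproj W (vsval (f_ b x (vsC (r2v (row j (invmx (gram b))))))))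
        (r2v (delta_mx 0 j)).
have yx : tens_incl L y = x.
  rewrite tens_incl_sum // [RHS]tensor_dual_basis; apply: eq_bigr => j _.
  rewrite tens_incl_pure //; congr tpure; rewrite (vsprojK (U := W)) ?vsvalK //.
  by apply/XP; eexists.
exists (existT _ W (T_ b y)), y; split=> //= w.
have /XP[v vE] := subvsP w; exists v; apply: val_inj.
by rewrite /= -(f_tens_incl b WL) yx vE.
Qed.

(** W must be Im f_x; then y is determined since W (x) V embeds in L (x) V, and with it the tensor
    T_W(y). *)
Lemma orbit_pair_unique x Wi Wi' : orbit_pair x Wi -> orbit_pair x Wi' -> Wi = Wi'.
Proof.
move=> h h'; have imW := orbit_pair_image h; have imW' := orbit_pair_image h'.
case: Wi Wi' h h' imW imW' => W i [W' i'] [y /= [WL yx _ Ty]] [y' /= [_ y'x _ Ty']].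
move=> imW imW'; have WW' : W = W'.
  by apply: val_inj; apply/vspaceP => u; apply/idP/idP => [/imW/imW'|/imW'/imW].
case: W' / WW' i' y' y'x Ty' {imW imW'} => i' y' y'x Ty'.
have /(tens_incl_inj WL) eq_yy' : tens_incl L y = tens_incl L y' by rewrite yx y'x.
by rewrite -Ty -Ty' eq_yy'.
Qed.

Lemma orbit_pair_orbit x x' Wi :
  orbit_Ft b x x' -> orbit_pair x Wi -> orbit_pair x' Wi.
Proof.
case=> g og <-; case: Wi => W i [y /= [WL <- onto Ty]].
have yy' : orbit_Ft b y (act_Ft g y) by exists g.
exists (act_Ft g y); split=> //=; first exact: tens_incl_act.
  exact: f_onto_orbit yy' onto.
by rewrite -(T_orbit yy').
Qed.

Lemma orbit_pair_inj x x' Wi :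
  orbit_pair x Wi -> orbit_pair x' Wi -> orbit_Ft b x x'.
Proof.
case: Wi => W i [y /= [WL <- onto Ty]] [y' /= [_ <- onto' Ty']].
have two0 : 2%:R != 0 :> F by have /pcharf0P -> := F0.
have [|g og <-] := orbit_of_moment hb two0 onto onto'; first by rewrite Ty Ty'.
by exists g => //; rewrite tens_incl_act.
Qed.

Lemma pairs_FtP Wi : pairs_Ft b L Wi <-> exists x, orbit_pair x Wi.
Proof.
case: Wi => W i; split.
  case=> /= WL _ [y [Ty sub]]; exists (tens_incl L y), y; split=> //=.
  have gen := submersive_generating F0 sub.
  move=> w; apply: (surj_generating hb gen).
case=> _ [y /= [WL _ onto <-]]; split=> //=; first exact: T_S2t.
by exists y; split=> //; exact: surj_submersive.
Qed.

End Classification.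

Theorem theorem5p8 (F : fieldExtType rat) (M : sntModule F) (Mm Mp : submod M)
    (hM : lagrangian_decomposition Mm Mp)
    (V : vectType F) (b : {symmetric V}) (hb : nondegenerate b) :
  exists phi : set (tensF V Mm) -> {W : submod M & tens2 W},
    set_bij (orbits_Ft b Mm) (pairs_Ft b Mm) phi /\
    forall x : tensF V Mm,
      let W := projT1 (phi (orbit_Ft b x)) in
      let i := projT2 (phi (orbit_Ft b x)) in
      [set u : M | u \in (W : {vspace M})] = [set vsval (f_ b x v) | v in setT] /\
      exists2 y : tensF V W, tens_incl Mm y = x & T_ b y = i.
Proof.
have F0 : [pchar F] =i pred0.
  by move=> p; rewrite (pchar_lalg F) Num.Theory.pchar_num.
(* Requiring the property for every representative of O makes the chosen pair a function of the
   orbit alone. *)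
pose represents (O : set (tensF V Mm)) Wi :=
  forall x, O = orbit_Ft b x -> orbit_pair b x Wi.
have [O|phi phiP] := @choice _ _ represents.
  have [[x ->]|noO] := pselect (exists x, O = orbit_Ft b x).
    have [Wi xWi] := orbit_pair_exists hb x; exists Wi => x' xx'.
    by apply: orbit_pair_orbit xWi; rewrite xx'; exact: orbit_refl.
  (* An arbitrary value for the sets that are not orbits. *)
  exists (existT _ Mm (0 : tens2 Mm)) => x Ox.
  by case: noO; exists x.
have phiE x : orbit_pair b x (phi (orbit_Ft b x)) by exact: phiP.
exists phi; split; last first.
  move=> x W i; split; last by have [y [_ yx _ Ty]] := phiE x; exists y.
  apply/seteqP; split=> u; first by move=> /(orbit_pair_image (phiE x))[v vE]; exists v.
  by case=> v _ vE; apply/(orbit_pair_image (phiE x)); exists v.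
split.
- by move=> _ [x _ <-]; apply/pairs_FtP => //; exists x.
- move=> O O' /set_mem[x _ <-] /set_mem[x' _ <-] eq_phi; apply: eq_orbit.
  by apply: (orbit_pair_inj hb F0 (phiE x)); rewrite eq_phi.
move=> Wi /(pairs_FtP hb F0)[x xWi]; exists (orbit_Ft b x); first by exists x.
exact: orbit_pair_unique (phiE x) xWi.
Qed.
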